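(* Let $D$ be a divisor of the algebraic function field $F/k$ with ideal representation $(I,I_\infty)$, let $\|\cdot\|=\|\cdot\|_D$, let $r\in\mathbb{Z}$, and let $\mathcal{B}=(b_1,\dots,b_n)$ be a semi-reduced basis of the lattice $(I,\|\cdot\|)$. Then: (1) $I_\infty=(F,\|\cdot\|)_{\le0}$; (2) the set $\{b_it^{j_i}: 1\le i\le n,\ 0\le j_i\le -\lceil\|b_i\|\rceil+r\}$ is a $k$-basis of $\mathcal{L}(D+r(t)_\infty)$; (3) $\dim_k\mathcal{L}(D+r(t)_\infty)=\sum_{\lceil\|b_i\|\rceil\le r}\big(-\lceil\|b_i\|\rceil+r+1\big)$.
   Context: Let $k$ be a field, $A=k[t]$, $K=k(t)$, with degree function $|a/b|=\deg a-\deg b$ for nonzero $a,b\in A$, $|0|=-\infty$; $A_\infty=\{x\in K:|x|\le0\}$ with maximal ideal $P_\infty$. Let $F/k$ be an algebraic function field of one variable, where $F/K$ is a separable extension of finite degree $n$. $\mathbb{P}_F$ is the set of places of $F/k$, with surjective valuations $v_P:F\to\mathbb{Z}\cup\{\infty\}$; $\mathbb{P}_\infty(F)$ is the set of places over $P_\infty$ and $\mathbb{P}_0(F)=\mathbb{P}_F\setminus\mathbb{P}_\infty(F)$; $e(P/P_\infty)$ is the ramification index. For a divisor $D$, $v_P(D)$ is its coefficient at $P$ and $\mathcal{L}(D)=\{a\in F^*:v_P(a)\ge -v_P(D)\ \forall P\in\mathbb{P}_F\}\cup\{0\}$. Put $(t)_\infty=\sum_{P\in\mathbb{P}_\infty(F)}e(P/P_\infty)\,P$.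 Let $\mathcal{O}_F$ and $\mathcal{O}_{F,\infty}$ be the integral closures of $A$ and $A_\infty$ in $F$; their nonzero primes correspond to the finite, respectively infinite, places, the prime $\mathfrak{p}_P$ corresponding to $P$. The ideal representation of $D$ is $(I,I_\infty)$ with $I=\prod_{P\in\mathbb{P}_0(F)}\mathfrak{p}_P^{-v_P(D)}$ and $I_\infty=\prod_{P\in\mathbb{P}_\infty(F)}\mathfrak{p}_P^{-v_P(D)}$; $I$ is a free $A$-module of rank $n$. The norm is $$\|z\|_D=-\min_{P\in\mathbb{P}_\infty(F)}\frac{v_P(z)+v_P(D)}{e(P/P_\infty)},$$ and $(F,\|\cdot\|)_{\le0}=\{z\in F:\|z\|\le0\}$. By a basis of $I$ one means an $A$-basis. A subset $\{b_1,\dots,b_m\}$ is semi-reduced if $\big\lceil\|\sum_{i=1}^ma_ib_i\|\big\rceil=\max_{1\le i\le m}\lceil\|a_ib_i\|\rceil$ for all $a_1,\dots,a_m\in K$ (with $\lceil-\infty\rceil=-\infty$). *)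

(* Defs.v *)
From HB Require Import structures.
From mathcomp Require Import all_boot all_order all_algebra all_field.
From mathcomp Require Import finmap.
From mathcomp Require Import mathcomp_extra boolp classical_sets functions.
From mathcomp Require Import cardinality fsbigop constructive_ereal.

Set Implicit Arguments.
Unset Strict Implicit.
Unset Printing Implicit Defensive.

Import Order.TTheory GRing.Theory Num.Theory.

Local Open Scope classical_set_scope.
Local Open Scope ring_scope.

(* Values of degree functions and valuations live in \bar int (resp. \bar rat),
   i.e. int (resp. rat) extended by -oo and +oo. *)

Section RationalFunctions.
Variable k : fieldType.

Notation K := {fraction {poly k}}.

(* |a / b| = deg a - deg b; the shift by 1 between size and degree cancels,
   and the value does not depend on the chosen representative of x. *)
Definition degK (x : K) : \bar int :=
  if x == 0 then -oo%E
  else ((size (frac (repr x)).1)%:Z - (size (frac (repr x)).2)%:Z)%:E.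

Definition polyK : set K := range (fun a : {poly k} => tofrac a).

Definition A_infty : set K := [set x | (degK x <= 0)%E].
Definition P_infty : set K := [set x | (degK x < 0)%E].

End RationalFunctions.

Section FunctionField.
Variables (k : fieldType) (F : fieldExtType {fraction {poly k}}).

Notation K := {fraction {poly k}}.

Definition tF : F := (tofrac ('X : {poly k}))%:A.

Definition kscale (c : k) (x : F) : F := tofrac c%:P *: x.

(* A place of F/k is represented by its normalized discrete valuation
   F ->> Z U {+oo}, trivial on k. *)
Record place := Place {
  vP :> F -> \bar int;
  vP_surj : range vP = [set~ -oo%E];
  vP_eqy : forall x, vP x = +oo%E <-> x = 0;
  vPM : forall x y, vP (x * y) = (vP x + vP y)%E;
  vPD : forall x y, (Order.min (vP x) (vP y) <= vP (x + y))%E;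
  vP_const : forall c : k, c != 0 -> vP (kscale c 1) = 0%E }.

HB.instance Definition _ := gen_eqMixin place.
HB.instance Definition _ := gen_choiceMixin place.

(* The places P with P ∩ K = P_infty. *)
Definition infinite_places : set place :=
  [set P : place | [set x : K | (0 < P x%:A)%E] = @P_infty k].

Definition finite_places : set place := ~` infinite_places.

(* e(P/P_infty), characterized by v_P(x) = e * v_{P_infty}(x) for x in K, where
   v_{P_infty}(x) = - |x|. Such an e exists and is unique when P is infinite. *)
Definition ramification_index (P : place) : nat :=
  xget 0%N [set e : nat | forall x : K,
    P x%:A = ((e%:Z)%:E * - degK x)%E].

(* Divisors are functions on places; v_P(D) is D P. *)
Definition is_divisor (D : place -> int) : Prop :=
  finite_set [set P | D P != 0].

(* The divisor (t)_infty. *)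
Definition t_infty (P : place) : int :=
  if P \in infinite_places then (ramification_index P)%:Z else 0.

Definition riemann_roch (D : place -> int) : set F :=
  [set a | a != 0 /\ forall P : place, ((- D P)%:E <= P a)%E] `|` [set 0].

(* Elements of F integral over the subring of K with underlying set S. *)
Definition integral_closure (S : set K) : set F :=
  [set x | exists p : {poly K},
    [/\ p \is monic, forall i, S p`_i & root (map_poly (in_alg F) p) x]].

Definition O_fin : set F := integral_closure (@polyK k).
Definition O_inf : set F := integral_closure (@A_infty k).

(* Fractional ideals of a subring O of F with quotient field F. *)
Definition fid_mul (I J : set F) : set F :=
  [set x | exists s : seq (F * F),
    (forall p, p \in s -> I p.1 /\ J p.2) /\ x = \sum_(p <- s) p.1 * p.2].

Definition fid_inv (O I : set F) : set F :=
  [set x | forall y, I y -> O (x * y)].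

Definition fid_exp (O I : set F) (m : int) : set F :=
  match m with
  | Posz n => iter n (fid_mul I) O
  | Negz n => iter n.+1 (fid_mul (fid_inv O I)) O
  end.

(* The prime of O corresponding to P. *)
Definition prime_of (O : set F) (P : place) : set F :=
  [set x | O x /\ (0 < P x)%E].

(* The two components I and I_infty of the ideal representation of D. *)
Definition ideal_fin (D : place -> int) : set F :=
  \big[fid_mul/O_fin]_(P \in finite_places)
    fid_exp O_fin (prime_of O_fin P) (- D P).

Definition ideal_inf (D : place -> int) : set F :=
  \big[fid_mul/O_inf]_(P \in infinite_places)
    fid_exp O_inf (prime_of O_inf P) (- D P).

Definition normD (D : place -> int) (z : F) : \bar rat :=
  (- \big[Order.min/+oo]_(P \in infinite_places)
      er_map (fun m : int => (m%:~R / (ramification_index P)%:R : rat)%R)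
        (P z + (D P)%:E))%E.

Definition ceilE (x : \bar rat) : \bar int :=
  er_map (Num.ceil : rat -> int) x.

Definition norm_le0 (N : F -> \bar rat) : set F := [set z | (N z <= 0)%E].

Definition is_A_basis (n : nat) (b : 'I_n -> F) (I : set F) : Prop :=
  I = range (fun a : 'I_n -> {poly k} => \sum_(i < n) tofrac (a i) *: b i) /\
  forall a : 'I_n -> {poly k},
    \sum_(i < n) tofrac (a i) *: b i = 0 -> forall i, a i = 0.

Definition semi_reduced (N : F -> \bar rat) (m : nat) (b : 'I_m -> F) : Prop :=
  forall a : 'I_m -> K,
    ceilE (N (\sum_(i < m) a i *: b i)) =
    (\big[Order.max/-oo]_(i < m) ceilE (N (a i *: b i)))%E.

Definition is_k_basis (S V : set F) : Prop :=
  (forall (X : {fset F}) (c : F -> k), [set` X] `<=` S ->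
     \sum_(x <- X) kscale (c x) x = 0 -> forall x, x \in X -> c x = 0) /\
  V = [set y | exists (X : {fset F}) (c : F -> k),
         [set` X] `<=` S /\ y = \sum_(x <- X) kscale (c x) x].

(* The number of elements of a finite k-basis of V, if there is one. *)
Definition dim_k (V : set F) : nat :=
  xget 0%N [set d : nat | exists S : set F, is_k_basis S V /\ (S #= `I_d)%card].

End FunctionField.

(* Main.v *)
Require Import Defs.
From HB Require Import structures.
From mathcomp Require Import all_boot all_order all_algebra all_field.
From mathcomp Require Import finmap ring.
From mathcomp Require Import mathcomp_extra boolp classical_sets functions.
From mathcomp Require Import cardinality fsbigop constructive_ereal.

Set Implicit Arguments.
Unset Strict Implicit.
Unset Printing Implicit Defensive.

Import Order.TTheory GRing.Theory Num.Theory.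

Local Open Scope classical_set_scope.
Local Open Scope ring_scope.

(** An element x of F lies in L(D + r (t)_oo) exactly when it has enough
    valuation at the finite places, that is x \in I, and when
    v_P(x) + v_P(D) >= - r e(P) at the infinite ones, that is when the rounded
    up norm of x is at most r ([riemann_rochE]).  Write x = sum a_i b_i with
    a_i in k[t].  By semi-reducedness the norm condition splits into one
    condition for each i, and as multiplication by a_i adds deg a_i to the norm
    it reads deg a_i <= r - ceil ||b_i|| ([ceil_norm_scale]).  The b_i t^j with
    j <= r - ceil ||b_i|| therefore span the space over k; they are independent
    because the b_i are independent over k[t], and counting them gives the
    dimension.

    What has to be built is the dictionary between ideals and valuations:
    I and I_oo, defined as products of powers of primes of integral closures,
    are the sets cut out by v_P(x) >= - v_P(D).  It is obtained at once for
    k[t] with the finite places and for the valuation ring of K at infinity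
    with the infinite places, from a list of common properties
    ([place_family]).  Three facts carry it.
    - [chevalley]: a proper ideal of a subring of F lies in the maximal ideal of
      some valuation ring that contains the subring.  By [discrete_place] such a
      valuation ring comes from a place, so that there are enough places: the
      integral closure is the intersection of the valuation rings
      ([hol_ring_integral]), the ideal I(D) I(-D), which is contained in
      the prime of no place, is the unit ideal ([divisorial_invertible]), and there is an
      infinite place ([infinite_place_exists]).
    - [localization]: the valuation ring of P is the localization of the
      integral closure at the prime of P.  This separates places, bounds the
      number of places above one prime of K ([finite_above]), and so shows that
      an element has finitely many poles.
    - [divisorial_exact]: given a divisor D and a place P there is an element
      of value at least D everywhere and equal to D at P.

    Together they give I(D) I(E) = I(D + E) ([divisorial_mul]) and hence the
    product formula ([prod_divisorial]).  Existence and finiteness of the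
    infinite places are also what makes the norm a minimum of finitely many
    finite terms, so that the numbers ceil ||b_i|| are integers. *)

(** * Valuation rings and Chevalley's extension theorem *)

Section ValuationRings.
Variable E : fieldType.
Implicit Types (R S V J : set E) (x y z : E).

Definition subring S :=
  [/\ S 1, forall x y, S x -> S y -> S (x - y)
    & forall x y, S x -> S y -> S (x * y)].

Definition valuation_ring V := subring V /\ forall x, V x \/ V x^-1.

(** The description by inverses is the right one only for a valuation ring. *)
Definition max_ideal V := [set x | x = 0 \/ ~ V x^-1].

Definition unit_of V := [set x | [/\ x != 0, V x & V x^-1]].

Section Subring.
Variables (S : set E) (Ssub : subring S).

Lemma subring1 : S 1. Proof. by case: Ssub. Qed.

Lemma subringB x y : S x -> S y -> S (x - y). Proof. by case: Ssub => _ + _; apply. Qed.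

Lemma subringM x y : S x -> S y -> S (x * y). Proof. by case: Ssub => _ _; apply. Qed.

Lemma subring0 : S 0.
Proof. by rewrite -(subrr 1); apply: subringB; exact: subring1. Qed.

Lemma subringN x : S x -> S (- x).
Proof. by move=> Sx; rewrite -sub0r; apply: subringB => //; exact: subring0. Qed.

Lemma subringD x y : S x -> S y -> S (x + y).
Proof. by move=> Sx Sy; rewrite -[y]opprK; apply: subringB => //; exact: subringN. Qed.

Lemma subringX x m : S x -> S (x ^+ m).
Proof.
by move=> Sx; elim: m => [|m IH]; [exact: subring1|rewrite exprS; exact: subringM].
Qed.

Lemma subring_sum (I : Type) (s : seq I) (P : pred I) (f : I -> E) :
  (forall i, P i -> S (f i)) -> S (\sum_(i <- s | P i) f i).
Proof.
by move=> Sf; elim/big_ind: _ => //; [exact: subring0|move=> *; exact: subringD].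
Qed.

End Subring.

Definition adjoin S y :=
  [set z | exists2 p : {poly E}, (forall i, S p`_i) & z = p.[y]].

Lemma adjoin_subring S y : subring S -> subring (adjoin S y).
Proof.
move=> Ssub; split.
- exists 1; last by rewrite hornerC.
  by move=> i; rewrite coef1; case: eqP => _;
    [exact: subring1|exact: subring0].
- move=> _ _ [p Sp ->] [q Sq ->]; exists (p - q); last by rewrite hornerD hornerN.
  by move=> i; rewrite coefB; exact: subringB.
- move=> _ _ [p Sp ->] [q Sq ->]; exists (p * q); last by rewrite hornerM.
  by move=> i; rewrite coefM; apply: subring_sum => // j _; exact: subringM.
Qed.

Lemma sub_adjoin S y : subring S -> S `<=` adjoin S y.
Proof.
move=> Ssub x Sx; exists x%:P; last by rewrite hornerC.
by move=> i; rewrite coefC; case: eqP => _ //; exact: subring0.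
Qed.

Lemma mem_adjoin S y : subring S -> adjoin S y y.
Proof.
move=> Ssub; exists 'X; last by rewrite hornerX.
by move=> i; rewrite coefX; case: eqP => _; [exact: subring1|exact: subring0].
Qed.

(** When S is a subring containing J this is the ideal of S generated by J. *)
Definition span_mul J S : set E :=
  [set x | exists s : seq (E * E),
    (forall p : E * E, p \in s -> J p.1 /\ S p.2) /\ x = \sum_(p <- s) p.1 * p.2].

Lemma span_mul0 J S : span_mul J S 0.
Proof. by exists [::]; rewrite big_nil. Qed.

Lemma span_mulD J S x y : span_mul J S x -> span_mul J S y -> span_mul J S (x + y).
Proof.
move=> [s [Hs ->]] [s' [Hs' ->]]; exists (s ++ s'); split; last by rewrite big_cat.
by move=> p; rewrite mem_cat => /orP[/Hs|/Hs'].
Qed.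

Lemma span_mul_mem J S x y : J x -> S y -> span_mul J S (x * y).
Proof.
move=> Jx Sy; exists [:: (x, y)]; split; last by rewrite big_seq1.
by move=> p; rewrite inE => /eqP ->.
Qed.

Lemma span_mul_ind J S (P : set E) : P 0 -> (forall x y, P x -> P y -> P (x + y)) ->
  (forall x y, J x -> S y -> P (x * y)) -> span_mul J S `<=` P.
Proof.
move=> P0 PD PM x [s [Hs ->]]; rewrite big_seq; elim/big_ind: _ => // p ps.
by apply: PM; case: (Hs p ps).
Qed.

Lemma span_mulM J S x y : subring S -> span_mul J S x -> S y -> span_mul J S (x * y).
Proof.
move=> Ssub Hx Sy; move: x Hx.
apply: (@span_mul_ind _ _ (fun x => span_mul J S (x * y))).
- by rewrite mul0r; exact: span_mul0.
- by move=> x x' ? ?; rewrite mulrDl; exact: span_mulD.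
- by move=> x x' ? ?; rewrite -mulrA; apply: span_mul_mem => //; exact: subringM.
Qed.

Lemma span_mul_sub J S : subring S -> J `<=` S -> span_mul J S `<=` S.
Proof.
move=> Ssub JS; apply: span_mul_ind; first exact: subring0.
  by move=> *; exact: subringD.
by move=> x y Jx Sy; apply: subringM => //; exact: JS.
Qed.

Lemma span_mul_sum J S (I : Type) (s : seq I) (P : pred I) (f : I -> E) :
  (forall i, P i -> span_mul J S (f i)) -> span_mul J S (\sum_(i <- s | P i) f i).
Proof.
by move=> Sf; elim/big_ind: _ => //; [exact: span_mul0|move=> *; exact: span_mulD].
Qed.

Lemma span_mul_principal S u x : subring S -> span_mul [set u] S x ->
  exists2 y, S y & x = u * y.
Proof.
move=> Ssub; move: x; apply: span_mul_ind.
- by exists 0; rewrite ?mulr0 //; exact: subring0.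
- move=> _ _ [y Sy ->] [z Sz ->]; exists (y + z); rewrite ?mulrDr //.
  exact: subringD.
- by move=> _ y -> Sy; exists y.
Qed.

Lemma span_mul_adjoin J S y x : subring S -> span_mul J (adjoin S y) x ->
  exists2 p : {poly E}, (forall i, span_mul J S p`_i) & x = p.[y].
Proof.
move=> Ssub; move: x; apply: span_mul_ind.
- by exists 0; [move=> i; rewrite coef0; exact: span_mul0|rewrite horner0].
- move=> _ _ [p Hp ->] [q Hq ->]; exists (p + q); last by rewrite hornerD.
  by move=> i; rewrite coefD; exact: span_mulD.
- move=> x _ Jx [p Sp ->]; exists (x *: p); last by rewrite hornerZ.
  by move=> i; rewrite coefZ; exact: span_mul_mem.
Qed.

Lemma span_mulS J S S' : S `<=` S' -> span_mul J S `<=` span_mul J S'.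
Proof. by move=> SS' x [s [Hs ->]]; exists s; split=> // p /Hs[? /SS']. Qed.

Definition avoids J S := subring S /\ ~ span_mul J S 1.

(** Such relations witness that J generates the unit ideal once y is adjoined
    to V; their degree is what the descent in [unit_rel_contra] decreases. *)
Definition unit_rel J V y m :=
  exists2 p : {poly E}, (forall i, span_mul J V p`_i) &
    ((size p <= m.+1)%N /\ 1 = p.[y]).

Lemma unit_rel_adjoin J V y : subring V -> span_mul J (adjoin V y) 1 ->
  exists m, unit_rel J V y m.
Proof.
move=> Vsub /(span_mul_adjoin Vsub)[p Hp e]; exists (size p); exists p => //.
Qed.

(** Expanding (1 - d)^m modulo the ideal shows that 1 - d lies in no proper
    ideal containing d. *)
Lemma span_mul_expB1 J V d m : subring V -> J `<=` V -> span_mul J V d ->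
  span_mul J V ((1 - d) ^+ m) -> span_mul J V 1.
Proof.
move=> Vsub JV Hd; elim: m => [|m IH] //; rewrite exprS => H.
apply: IH; rewrite -[X in span_mul _ _ X](subrK ((1 - d) * (1 - d) ^+ m)).
apply: span_mulD => //; rewrite mulrBl mul1r opprB addrCA subrr addr0.
apply: span_mulM => //; apply: subringX => //; apply: subringB => //.
  exact: subring1.
exact: span_mul_sub Hd.
Qed.

(** If adjoining the inverse of 1 - d made J generate 1, clearing denominators
    would put a power of 1 - d in the ideal; so maximality applies. *)
Lemma chevalley_inv J V d : subring V -> J `<=` V -> ~ span_mul J V 1 ->
  (forall w, ~ span_mul J (adjoin V w) 1 -> V w) ->
  span_mul J V d -> 1 - d != 0 /\ V (1 - d)^-1.
Proof.
move=> Vsub JV V1 Vmax Hd.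
have d1 : 1 - d != 0.
  by apply/eqP => /subr0_eq d1; apply: V1; rewrite d1.
split=> //; apply: Vmax => /(unit_rel_adjoin Vsub)[m [p Hp [sp e]]].
apply: V1; apply: (@span_mul_expB1 _ _ d m) => //.
have V1d : V (1 - d) by apply: subringB; [|exact: subring1|exact: span_mul_sub Hd].
rewrite -[X in span_mul _ _ X]mul1r {1}e (horner_coef_wide _ sp) mulr_suml.
apply: span_mul_sum => i _; rewrite -mulrA; apply: span_mulM => //.
rewrite exprVn mulrC -expfB_cond; first exact: subringX.
have := ltn_ord i; rewrite ltnS => im; by case: eqP d1.
Qed.

(** Eliminating the top power of y with the help of the relation for y^-1. *)
Lemma unit_rel_step J V y m l : subring V -> J `<=` V ->
  (forall d, span_mul J V d -> 1 - d != 0 /\ V (1 - d)^-1) -> y != 0 ->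
  (l <= m)%N -> (0 < l)%N -> unit_rel J V y m -> unit_rel J V y^-1 l ->
  exists2 m', (m' < m)%N & unit_rel J V y m'.
Proof.
move=> Vsub JV Vinv y0 lm l0 [p Hp [sp e]] [q Hq [sq f]].
have m0 : (0 < m)%N by exact: leq_trans lm.
have [q1 Vq1] := Vinv _ (Hq 0%N).
set w := (1 - q`_0)^-1 in Vq1.
have ym : y ^+ m = \sum_(1 <= j < l.+1) (w * q`_j) * y ^+ (m - j).
  have : 1 - q`_0 = \sum_(1 <= j < l.+1) q`_j * y^-1 ^+ j.
    rewrite {1}f (horner_coef_wide _ sq).
    rewrite -(big_mkord xpredT (fun j => q`_j * y^-1 ^+ j)).
    by rewrite big_nat_recl // expr0 mulr1 addrAC subrr add0r big_add1.
  move/(congr1 (fun z => w * z * y ^+ m)); rewrite mulVf // mul1r => ->.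
  rewrite mulr_sumr mulr_suml; apply: eq_big_nat => j /andP[j0 jl].
  rewrite -!mulrA exprVn [y ^- j * _]mulrC -expfB_cond ?(negPf y0) //=.
  by rewrite (leq_trans _ lm).
exists m.-1; first by rewrite prednK.
exists (\sum_(i < m) p`_i *: 'X^i +
        \sum_(1 <= j < l.+1) (p`_m * (w * q`_j)) *: 'X^(m - j)).
  move=> i; rewrite coefD !coef_sum; apply: span_mulD.
    apply: span_mul_sum => j _; rewrite coefZ coefXn; apply: span_mulM => //.
    by case: eqP => _; [exact: subring1|exact: subring0].
  rewrite big_nat; apply: span_mul_sum => j _; rewrite coefZ coefXn -mulrA.
  apply: span_mulM => //; apply: subringM => //.
    apply: subringM => //; exact: span_mul_sub (Hq j).
  by case: eqP => _; [exact: subring1|exact: subring0].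
split.
  rewrite prednK //; apply: leq_trans (size_polyD _ _) _; rewrite geq_max.
  apply/andP; split; apply: leq_trans (size_sum _ _ _) _; apply/bigmax_leqP_seq.
    move=> j _ _; apply: leq_trans (size_scale_leq _ _) _.
    by rewrite size_polyXn.
  move=> j; rewrite mem_index_iota => /andP[j0 jl] _.
  apply: leq_trans (size_scale_leq _ _) _; rewrite size_polyXn.
  by rewrite ltn_subrL j0 m0.
rewrite hornerD !horner_sum {1}e (horner_coef_wide _ sp) big_ord_recr /= ym.
congr (_ + _); first by apply: eq_bigr => i _; rewrite hornerZ hornerXn.
rewrite mulr_sumr; apply: eq_bigr => j _.
by rewrite hornerZ hornerXn !mulrA.
Qed.

(** Of the two relations, for y and for y^-1, the one of larger degree is
    shortened by means of the other until one of them has degree 0 and says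
    that 1 lies in the ideal. *)
Lemma unit_rel_contra J V y m l : subring V -> J `<=` V -> ~ span_mul J V 1 ->
  (forall d, span_mul J V d -> 1 - d != 0 /\ V (1 - d)^-1) -> y != 0 ->
  unit_rel J V y m -> unit_rel J V y^-1 l -> False.
Proof.
move=> Vsub JV V1 Vinv.
have base z : unit_rel J V z 0 -> False.
  move=> [p Hp [sp e]]; apply: V1; rewrite e (horner_coef_wide _ sp) big_ord1.
  by rewrite expr0 mulr1.
have [N] := ubnP (m + l); elim: N => // N IH in y m l *.
rewrite ltnS => mlN y0 Hm Hl.
have [lm|/ltnW ml] := leqP l m.
  case: l => [|l] in mlN Hl lm *; first exact: base Hl.
  have [m' m'm Hm'] := unit_rel_step Vsub JV Vinv y0 lm isT Hm Hl.
  by apply: (IH y m' l.+1) => //; apply: leq_trans mlN; rewrite ltn_add2r.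
case: m => [|m] in mlN Hm ml *; first exact: base Hm.
have y'0 : y^-1 != 0 by rewrite invr_eq0.
have Hm' := Hm; rewrite -[y]invrK in Hm'.
have [l' l'l Hl'] := unit_rel_step Vsub JV Vinv y'0 ml isT Hl Hm'.
by apply: (IH y m.+1 l') => //; apply: leq_trans mlN; rewrite ltn_add2l.
Qed.

Lemma chevalley_maximal J V : subring V -> J `<=` V -> ~ span_mul J V 1 ->
  (forall w, ~ span_mul J (adjoin V w) 1 -> V w) -> valuation_ring V.
Proof.
move=> Vsub JV V1 Vmax; split=> // y; apply: contrapT => /not_orP[Vy Vy'].
have y0 : y != 0.
  by apply/eqP => y0; apply: Vy; rewrite y0; exact: subring0.
have [m Hm] : exists m, unit_rel J V y m.
  by apply: unit_rel_adjoin => //; apply: contrapT => /Vmax.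
have [l Hl] : exists m, unit_rel J V y^-1 m.
  by apply: unit_rel_adjoin => //; apply: contrapT => /Vmax.
by apply: unit_rel_contra Hm Hl => // d; exact: chevalley_inv.
Qed.

(** Finitely many elements of a union of a chain lie in a common member, so
    that being a subring in which J generates a proper ideal passes to such
    unions. *)
Lemma avoids_chain J R (C : set (set E)) : avoids J R ->
  (forall X, C X -> avoids J (X `|` R)) -> total_on C subset ->
  avoids J (\bigcup_(X in C) X `|` R).
Proof.
move=> aR aC totC; set U := _ `|` R.
have [[X0 CX0]|C0] := pselect (exists X, C X); last first.
  suff -> : U = R by [].
  rewrite /U bigcup0 ?set0U // => X CX; exfalso; apply: C0; by exists X.
have inU x : U x <-> exists2 X, C X & (X `|` R) x.
  split=> [[[X CX Xx]|Rx]|[X CX [Xx|Rx]]].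
  - by exists X => //; left.
  - by exists X0 => //; right.
  - by left; exists X.
  - by right.
have both X Y : C X -> C Y ->
    exists Z, [/\ C Z, X `|` R `<=` Z `|` R & Y `|` R `<=` Z `|` R].
  move=> CX CY; case: (totC _ _ CX CY) => XY; [exists Y|exists X]; split=> //;
    exact: setSU.
have two x y : U x -> U y -> exists X, [/\ C X, (X `|` R) x & (X `|` R) y].
  move=> /inU[X CX Xx] /inU[Y CY Yy]; have [Z [CZ XZ YZ]] := both _ _ CX CY.
  by exists Z; split=> //; [exact: XZ|exact: YZ].
split; first split.
- by right; case: aR => -[].
- move=> x y Ux Uy; have [X [CX Xx Xy]] := two _ _ Ux Uy; apply/inU; exists X => //.
  by case: (aC _ CX) => Xs _; exact: subringB.
- move=> x y Ux Uy; have [X [CX Xx Xy]] := two _ _ Ux Uy; apply/inU; exists X => //.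
  by case: (aC _ CX) => Xs _; exact: subringM.
have main z : span_mul J U z -> exists2 X, C X & span_mul J (X `|` R) z.
  move: z; apply: span_mul_ind.
  - by exists X0 => //; exact: span_mul0.
  - move=> x y [X CX Xx] [Y CY Yy]; have [Z [CZ XZ YZ]] := both _ _ CX CY.
    by exists Z => //; apply: span_mulD; [exact: span_mulS Xx|exact: span_mulS Yy].
  - by move=> x y Jx /inU[X CX Xy]; exists X => //; exact: span_mul_mem.
by move=> /main[X CX]; case: (aC _ CX).
Qed.

(** Among the overrings of R in which J still generates a proper
    ideal a maximal one is a valuation ring. *)
Theorem chevalley R J : subring R -> J `<=` R -> ~ span_mul J R 1 ->
  exists V, [/\ valuation_ring V, R `<=` V & J `<=` max_ideal V].
Proof.
move=> Rsub JR R1.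
have [|M [[Msub M1] Mmax]] := @Zorn_bigcup E [set X | avoids J (X `|` R)].
  by move=> C HC totC; apply: avoids_chain.
have RM : R `<=` M `|` R by move=> x; right.
exists (M `|` R); split=> //.
  apply: (chevalley_maximal Msub _ M1); first exact: subset_trans RM.
  move=> w Hw; apply: contrapT => Mw; apply: (Mmax (adjoin (M `|` R) w)); last first.
    rewrite /= (_ : _ `|` R = adjoin (M `|` R) w).
      by split=> //; exact: adjoin_subring.
    by apply/setUidPl; apply: subset_trans RM _; exact: sub_adjoin.
  split; first by apply: subset_trans (sub_adjoin _ Msub) => x; left.
  by move=> /(_ w (mem_adjoin w Msub)) Mw'; apply: Mw; left.
move=> x Jx; have [|x0] := eqVneq x 0; first by left.
right=> Vx; apply: M1; rewrite -(divff x0); exact: span_mul_mem.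
Qed.

End ValuationRings.

Section ValuationRingTheory.
Variables (E : fieldType) (V : set E).
Hypothesis Vval : valuation_ring V.
Let Vsub : subring V := Vval.1.
Implicit Types x y : E.

Lemma max_ideal_sub : max_ideal V `<=` V.
Proof.
move=> x [->|Vx]; first exact: subring0.
by have [//|] := Vval.2 x.
Qed.

Lemma max_ideal_unit x : V x -> x != 0 -> ~ max_ideal V x -> unit_of V x.
Proof.
move=> Vx x0 xm; split=> //; apply: contrapT => Vx'; apply: xm; by right.
Qed.

Lemma unit_of1 : unit_of V 1.
Proof. by split; rewrite ?oner_eq0 ?invr1 //; exact: subring1. Qed.

Lemma unit_ofV x : unit_of V x -> unit_of V x^-1.
Proof. by case=> x0 Vx Vx'; split; rewrite ?invr_eq0 ?invrK. Qed.

Lemma unit_ofM x y : unit_of V x -> unit_of V y -> unit_of V (x * y).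
Proof.
case=> x0 Vx Vx' [y0 Vy Vy']; split; first by rewrite mulf_neq0.
  exact: subringM.
by rewrite invfM; apply: subringM.
Qed.

Lemma unit_ofX x m : unit_of V x -> unit_of V (x ^+ m).
Proof.
move=> Ux; elim: m => [|m IH]; first exact: unit_of1.
by rewrite exprS; exact: unit_ofM.
Qed.

Lemma max_idealMl x y : max_ideal V x -> V y -> max_ideal V (x * y).
Proof.
case=> [->|Vx] Vy; first by left; rewrite mul0r.
have [->|y0] := eqVneq y 0; first by left; rewrite mulr0.
right; rewrite invfM => Vxy; apply: Vx; rewrite -[x^-1](mulfVK y0).
exact: subringM.
Qed.

Lemma max_ideal1 : ~ max_ideal V 1.
Proof. by case=> [/eqP|]; rewrite ?oner_eq0 // invr1; case; exact: subring1. Qed.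

Lemma unit_of_max x : unit_of V x -> ~ max_ideal V x.
Proof.
case=> x0 _ Vx' xm; apply: max_ideal1; rewrite -(divff x0); exact: max_idealMl.
Qed.

Lemma max_idealD x y : max_ideal V x -> max_ideal V y -> max_ideal V (x + y).
Proof.
have H x' y' : max_ideal V x' -> y' != 0 -> max_ideal V y' -> V (x' / y') ->
    max_ideal V (x' + y').
  move=> _ y0 ym Vxy.
  have -> : x' + y' = y' * (x' / y' + 1) by rewrite mulrDr mulr1 mulrC mulfVK.
  by apply: max_idealMl => //; apply: subringD => //; exact: subring1.
have [->|x0] := eqVneq x 0; first by rewrite add0r.
have [->|y0] := eqVneq y 0; first by rewrite addr0.
move=> xm ym; have [|] := Vval.2 (x / y); first exact: H.
by rewrite invfM invrK mulrC addrC; exact: H.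
Qed.

Lemma max_ideal_sum (I : Type) (s : seq I) (P : pred I) (f : I -> E) :
  (forall i, P i -> max_ideal V (f i)) -> max_ideal V (\sum_(i <- s | P i) f i).
Proof.
by move=> Sf; elim/big_ind: _ => //; [left|exact: max_idealD].
Qed.

(** If x were not in V, dividing the integral equation by a power of x would
    express x through powers of x^-1, which lie in V. *)
Lemma valuation_ring_integral (p : {poly E}) x :
  p \is monic -> (forall i, V p`_i) -> root p x -> V x.
Proof.
move=> pm Vp /rootP px; have [//|Vx'] := Vval.2 x.
have [->|x0] := eqVneq x 0; first exact: subring0.
have sp : (0 < size p)%N by rewrite size_poly_gt0 monic_neq0.
move: px; rewrite horner_coef -(prednK sp) big_ord_recr /=.
rewrite -[_.-1]/(size p).-1 -/(lead_coef p) (monicP pm) mul1r.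
case: (size p).-1 => [|m].
  by rewrite big_ord0 add0r expr0 => /eqP; rewrite oner_eq0.
rewrite addrC => /(canRL (addrK _)); rewrite sub0r.
move/(congr1 (fun z => z * x^-1 ^+ m)).
rewrite exprVn exprS mulfK ?expf_neq0 // => ->; rewrite mulNr mulr_suml.
apply: subringN => //; apply: subring_sum => // i _.
rewrite -mulrA; apply: subringM => //.
have im : (i <= m)%N by rewrite -ltnS.
rewrite [x ^+ i * _](_ : _ = x^-1 ^+ (m - i)); first exact: subringX.
move: (nat_of_ord i) im => j jm; rewrite exprVn -{1}(subnK jm) exprD invfM.
rewrite mulrCA divff ?mulr1 //.
exact: expf_neq0.
Qed.

(** In a vanishing sum the least valuation cannot be attained only once. *)
Lemma sum0_unit_ratio (I : finType) (z : I -> E) :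
  \sum_i z i = 0 -> (exists i, z i != 0) ->
  exists i j, [/\ i != j, z i != 0, z j != 0 & unit_of V (z i / z j)].
Proof.
move=> z0 [i0 zi0].
have [i zi Vi] : exists2 i, z i != 0 & forall j, V (z j / z i).
  suff H (s : seq I) : (exists2 i, i \in s & z i != 0) ->
      exists2 i, z i != 0 & forall j, j \in s -> V (z j / z i).
    have [|i zi Hi] := H (enum I); first by exists i0; rewrite ?mem_enum.
    by exists i => // j; apply: Hi; rewrite mem_enum.
  elim: s => [[i]//|a s IH] [i1 i1s zi1].
  have [/IH[i zi Hi]|Hs] := pselect (exists2 i, i \in s & z i != 0); last first.
    have zs j : j \in s -> z j = 0.
      by move=> js; apply/eqP/negPn/negP => zj; apply: Hs; exists j.
    have {i1s} i1a : i1 = a.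
      by move: i1s zi1; rewrite inE => /predU1P[//|/zs ->]; rewrite eqxx.
    exists i1 => // j; rewrite inE -i1a => /predU1P[->|/zs ->].
      by rewrite divff //; exact: subring1.
    by rewrite mul0r; exact: subring0.
  have [Va|Va] := pselect (V (z a / z i)).
    by exists i => // j; rewrite inE => /predU1P[->|/Hi].
  have za : z a != 0.
    by apply/eqP => za; apply: Va; rewrite za mul0r; exact: subring0.
  have {}Va : V (z i / z a) by have [] := Vval.2 (z a / z i); rewrite ?invf_div.
  exists a => // j; rewrite inE => /predU1P[->|js].
    by rewrite divff //; exact: subring1.
  have -> : z j / z a = (z j / z i) * (z i / z a) by rewrite mulrA mulfVK.
  by apply: subringM => //; exact: Hi.
have : exists2 j, j != i & ~ max_ideal V (z j / z i).
  apply: contrapT => H; apply: max_ideal1.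
  have : \sum_j z j / z i = 0 by rewrite -mulr_suml z0 mul0r.
  rewrite (bigD1 i) //= divff // => /(canRL (addrK _)); rewrite sub0r => ->.
  rewrite -mulN1r mulrC; apply: max_idealMl; last first.
    by apply: subringN => //; exact: subring1.
  by apply: max_ideal_sum => j ji; apply: contrapT => jm; apply: H; exists j.
move=> [j ji jm]; have zj : z j != 0.
  by apply/eqP => zj; apply: jm; left; rewrite zj mul0r.
by exists j, i; split=> //; apply: max_ideal_unit; rewrite ?mulf_neq0 ?invr_eq0.
Qed.

End ValuationRingTheory.

(** * Discrete valuations and places *)

Section Valuations.
Variable E : fieldType.
Implicit Types x y : E.

(** A place without its field of constants. *)
Structure valuation := Valuation {
  vval :> E -> \bar int;
  vval_surj : range vval = [set~ -oo%E];
  vval_eqy : forall x, vval x = +oo%E <-> x = 0;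
  vvalM : forall x y, vval (x * y) = (vval x + vval y)%E;
  vvalD : forall x y, (Order.min (vval x) (vval y) <= vval (x + y)%R)%E }.

Implicit Types P Q : valuation.

Definition val_ring (v : E -> \bar int) : set E := [set x | (0 <= v x)%E].

(** The junk value 0 is taken at x = 0, where the valuation is +oo. *)
Definition vz (v : E -> \bar int) x : int := if v x is m%:E%E then m else 0.

Lemma vval0 P : P 0 = +oo%E. Proof. exact/vval_eqy. Qed.

Lemma vval_vz P x : x != 0 -> P x = (vz P x)%:E%E.
Proof.
move=> x0; rewrite /vz; case e : (P x) => [m||] //.
  by move/vval_eqy: e => /eqP; rewrite (negPf x0).
have : range P (P x) by exists x.
by rewrite vval_surj e => /(_ erefl).
Qed.

Lemma vzM P x y : x != 0 -> y != 0 -> vz P (x * y) = vz P x + vz P y.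
Proof.
move=> x0 y0; have := vvalM P x y; rewrite !vval_vz ?mulf_neq0 // -EFinD.
by case.
Qed.

Lemma vz1 P : vz P 1 = 0.
Proof.
have := @vzM P 1 1 (oner_neq0 _) (oner_neq0 _); rewrite mul1r => /eqP.
by rewrite -subr_eq0 opprD addNKr oppr_eq0 => /eqP.
Qed.

Lemma vzV P x : x != 0 -> vz P x^-1 = - vz P x.
Proof.
move=> x0; apply/eqP; rewrite -addr_eq0 -vzM ?invr_eq0 // mulVf //.
by rewrite vz1.
Qed.

Lemma vzX P x m : x != 0 -> vz P (x ^+ m) = vz P x *+ m.
Proof.
move=> x0; elim: m => [|m IH]; first by rewrite expr0 vz1.
by rewrite exprS vzM ?expf_neq0 // IH mulrS.
Qed.

Lemma vzXz P x (m : int) : x != 0 -> vz P (x ^ m) = vz P x * m.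
Proof.
move=> x0; case: m => m; first by rewrite -exprnP vzX // pmulrn mulrzz.
rewrite NegzE -exprnN vzV ?expf_neq0 // vzX // mulrN; congr (- _).
by rewrite pmulrn mulrzz.
Qed.

Lemma vval1 P : P 1 = 0%E.
Proof. by rewrite vval_vz ?oner_neq0 // vz1. Qed.

Lemma vvalN P x : P (- x) = P x.
Proof.
have [->|x0] := eqVneq x 0; first by rewrite oppr0.
rewrite -mulN1r vvalM; suff -> : P (-1) = 0%E by rewrite add0e.
rewrite vval_vz ?oppr_eq0 ?oner_neq0 //.
have := @vzM P (-1) (-1); rewrite oppr_eq0 oner_neq0 => /(_ isT isT).
rewrite mulrNN mul1r vz1 => /eqP; rewrite eq_sym -mulr2n -mulr_natr mulf_eq0 orbF.
by move=> /eqP ->.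
Qed.

Lemma val_ring_vz P x : x != 0 -> val_ring P x = (0 <= vz P x) :> Prop.
Proof. by move=> x0; rewrite /val_ring /= vval_vz // lee_fin. Qed.

Lemma vval_ge P (m : int) x : x != 0 -> (m%:E <= P x)%E = (m <= vz P x).
Proof. by move=> x0; rewrite vval_vz // lee_fin. Qed.

Lemma vval_geD P (m : \bar int) x y : (m <= P x -> m <= P y -> m <= P (x + y)%R)%E.
Proof. by move=> mx my; apply: le_trans (vvalD P x y); rewrite le_min mx my. Qed.

Lemma vval_gtD P (m : \bar int) x y : (m < P x -> m < P y -> m < P (x + y)%R)%E.
Proof. by move=> mx my; apply: lt_le_trans (vvalD P x y); rewrite lt_min mx my. Qed.

Lemma val_ring_subring P : subring (val_ring P).
Proof.
split=> [|x y|x y]; rewrite /val_ring /=.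
- by rewrite vval1.
- by move=> Vx Vy; apply: vval_geD => //; rewrite vvalN.
- by rewrite vvalM; exact: adde_ge0.
Qed.

Lemma val_ring_valuation P : valuation_ring (val_ring P).
Proof.
split=> [|x]; first exact: val_ring_subring.
have [->|x0] := eqVneq x 0; first by left; rewrite /val_ring /= vval0.
rewrite !val_ring_vz ?invr_eq0 // vzV // oppr_ge0.
by case: (lerP 0 (vz P x)) => [|/ltW]; [left|right].
Qed.

Lemma max_ideal_val P x : max_ideal (val_ring P) x <-> (0 < P x)%E.
Proof.
have [->|x0] := eqVneq x 0; first by rewrite vval0; split=> // _; left.
rewrite vval_vz // lte_fin; split=> [[/eqP|]|h]; first by rewrite (negPf x0).
  by rewrite val_ring_vz ?invr_eq0 // vzV // oppr_ge0 => /negP; rewrite -ltNge.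
by right; rewrite val_ring_vz ?invr_eq0 // vzV // oppr_ge0 leNgt h.
Qed.

Lemma unit_val P x : x != 0 -> unit_of (val_ring P) x <-> vz P x = 0.
Proof.
move=> x0; split=> [[_]|h]; last first.
  by split=> //; rewrite val_ring_vz ?invr_eq0 // ?vzV // h ?oppr0.
rewrite !val_ring_vz ?invr_eq0 // vzV // oppr_ge0 => h1 h2.
by apply/eqP; rewrite eq_le h1 h2.
Qed.

Lemma vval_unif P (m : int) : exists2 x, x != 0 & vz P x = m.
Proof.
have : [set~ -oo%E] (m%:E)%E by [].
rewrite -(vval_surj P) => -[x _ e]; exists x; last by rewrite /vz e.
by apply/eqP => x0; move: e; rewrite x0 vval0.
Qed.

(** A uniformizer of P generates the value group of Q, hence has value 1. *)
Lemma val_ring_sub_eq P Q : val_ring P `<=` val_ring Q -> forall x, P x = Q x.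
Proof.
move=> PQ x.
have [->|x0] := eqVneq x 0; first by rewrite !vval0.
have unitPQ u : u != 0 -> vz P u = 0 -> vz Q u = 0.
  move=> u0 /(unit_val P u0) [_ Vu Vu']; apply/(unit_val Q u0).
  by split=> //; exact: PQ.
have [p p0 vp] := vval_unif P 1.
have Qp y : y != 0 -> vz Q y = vz Q p * vz P y.
  move=> y0; have u0 : y * p ^ (- vz P y) != 0 by rewrite mulf_neq0 ?expfz_neq0.
  have := unitPQ _ u0; rewrite vzM ?expfz_neq0 // !vzXz // vp mul1r subrr.
  rewrite vzM ?expfz_neq0 // vzXz // mulrN => /(_ erefl) /eqP.
  by rewrite subr_eq0 => /eqP.
have [y y0 vy] := vval_unif Q 1.
have Qp0 : 0 <= vz Q p.
  by rewrite -val_ring_vz //; apply: PQ; rewrite val_ring_vz // vp.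
have : vz Q p = 1.
  have : (vz Q p %| vz Q y)%Z by rewrite (Qp y) // dvdz_mulr.
  by rewrite vy dvdz1 => /eqP; case: (vz Q p) Qp0 => //= m _ ->.
by move=> e; rewrite !vval_vz // Qp // e mul1r.
Qed.

End Valuations.

Section Places.
Variables (k : fieldType) (F : fieldExtType {fraction {poly k}}).
Implicit Types (P Q : place F) (x y : F).

Canonical place_valuation P : valuation F :=
  @Valuation F P (@vP_surj k F P) (@vP_eqy k F P) (@vPM k F P) (@vPD k F P).

Lemma val_ring_const P (c : k) : val_ring P (kscale c 1).
Proof.
have [->|c0] := eqVneq c 0.
  by rewrite /kscale tofrac0 scale0r; exact: subring0 (val_ring_subring (place_valuation P)).
by rewrite /val_ring /= vP_const.
Qed.

Lemma place_eq P Q : (P =1 Q) -> P = Q.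
Proof.
case: P => f f1 f2 f3 f4 f5; case: Q => g g1 g2 g3 g4 g5 /= fg.
have {fg} fg : f = g by apply/funext.
by subst g; congr Place; exact: Prop_irrelevance.
Qed.


End Places.

(** * Valuation rings of a finite extension are discrete *)

Lemma linear_dependence (K : fieldType) (F : vectType K) (m : nat) (v : 'I_m -> F) :
  (\dim {:F} < m)%N ->
  exists2 c : 'I_m -> K, (exists i, c i != 0) & \sum_(i < m) c i *: v i = 0.
Proof.
move=> dm; apply: contrapT => H.
have : free [tuple v i | i < m].
  apply/freeP => c sc i; apply/eqP/negPn/negP => ci; apply: H; exists c.
    by exists i.
  by rewrite -[RHS]sc; apply: eq_bigr => j _; rewrite -tnth_nth tnth_mktuple.
rewrite /free size_tuple => /eqP e.
by have := dimvS (subvf <<[tuple v i | i < m]>>); rewrite e leqNgt dm.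
Qed.

Lemma algebraic_relation (K : fieldType) (F : fieldExtType K) (x : F) :
  exists2 q : {poly K}, q != 0 & root (map_poly (in_alg F) q) x.
Proof.
pose m := (\dim {:F}).+1.
have [c [i ci] sc] := @linear_dependence _ F m (fun i => x ^+ i) (ltnSn _).
have qE j : (\poly_(i < m) c (inord i))`_j = if (j < m)%N then c (inord j) else 0.
  by rewrite coef_poly.
exists (\poly_(i < m) c (inord i)).
  apply/eqP => /(congr1 (fun p : {poly K} => p`_i)).
  by rewrite qE ltn_ord inord_val coef0 => /eqP; rewrite (negPf ci).
apply/rootP; rewrite map_polyE (@horner_coef_wide _ m); last first.
  apply: leq_trans (size_Poly _) _; rewrite size_map; exact: size_poly.
rewrite -[RHS]sc; apply: eq_bigr => j _.
rewrite -map_polyE coef_map /= qE ltn_ord inord_val.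
exact: mulr_algl.
Qed.

Section Discrete.
Variables (k : fieldType) (F : fieldExtType {fraction {poly k}}).
Local Notation K := {fraction {poly k}}.

Variables (V : set F) (p : K).
Hypothesis Vval : valuation_ring V.
Hypothesis Vk : forall c : k, V (kscale c 1).
Hypothesis p0 : p != 0.
Hypothesis pV : max_ideal V p%:A.
Hypothesis pgen : forall x : K, x != 0 ->
  exists m : int, unit_of V (x%:A / p%:A ^ m).

Let Vsub : subring V := Vval.1.
Let q : F := p%:A.
Let q0 : q != 0. Proof. by rewrite scaler_eq0 negb_or p0 oner_eq0. Qed.
Let M := (\dim {:F})`!.

Let max_pow (m : nat) : (0 < m)%N -> max_ideal V (q ^+ m).
Proof.
case: m => // m _; rewrite exprS; apply: max_idealMl => //.
by apply: subringX => //; exact: max_ideal_sub.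
Qed.

Let powK (m : nat) : (0 < m)%N -> ~ V (q ^- m).
Proof. by move=> /max_pow[/eqP|//]; rewrite (negPf (expf_neq0 _ q0)). Qed.

Let unit_pow (m : int) : unit_of V (q ^ m) -> m = 0.
Proof.
case: m => [[|m]|m] // [_ H1 H2]; first by case: (@powK m.+1).
by move: H1; rewrite NegzE -exprnN => /powK; case.
Qed.

(** Two of the terms c_i x^i of a K-linear relation between the powers of x
    have the same valuation; hence the factorial M clears the ramification of
    every x at once. *)
Let val_power x : x != 0 -> exists m : int, unit_of V (x ^+ M / q ^ m).
Proof.
move=> x0.
have [c [i ci] sc] := @linear_dependence _ F (\dim {:F}).+1
  (fun i : 'I_ _ => x ^+ i) (ltnSn _).
have nz (a : 'I_(\dim {:F}).+1) : c a *: x ^+ a != 0 -> c a != 0.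
  by rewrite scaler_eq0 negb_or => /andP[].
have [|a [b [ab /nz ca /nz cb U]]] := sum0_unit_ratio Vval sc.
  by exists i; rewrite scaler_eq0 negb_or ci expf_neq0.
have [s Us] := pgen ca; have [t Ut] := pgen cb.
have alg0 (d : K) : d != 0 -> d%:A != 0 :> F.
  by move=> d0; rewrite scaler_eq0 negb_or d0 oner_eq0.
have : unit_of V (x ^+ a / x ^+ b / q ^ (t - s)).
  have -> : x ^+ a / x ^+ b / q ^ (t - s) =
      (c a *: x ^+ a / (c b *: x ^+ b)) * ((c a)%:A / q ^ s)^-1 * ((c b)%:A / q ^ t).
    rewrite expfzDr // -invr_expz -(mulr_algl _ (x ^+ a)) -(mulr_algl _ (x ^+ b)).
    have := alg0 _ ca; have := alg0 _ cb; move: (c a)%:A (c b)%:A => u v v0 u0.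
    have xa : x ^+ a != 0 by rewrite expf_neq0.
    have xb : x ^+ b != 0 by rewrite expf_neq0.
    have qs : q ^ s != 0 by rewrite expfz_neq0.
    have qt : q ^ t != 0 by rewrite expfz_neq0.
    move: (x ^+ a) (x ^+ b) (q ^ s) (q ^ t) xa xb qs qt => xa xb qs qt xa0 xb0 qs0 qt0.
    by field; rewrite qt0 qs0 u0 xb0 v0.
  apply: unit_ofM => //; apply: unit_ofM => //; exact: unit_ofV.
have main (a' b' : nat) (l : int) : (b' <= \dim {:F})%N -> (a' < b')%N ->
    unit_of V (x ^+ b' / x ^+ a' / q ^ l) -> exists m : int, unit_of V (x ^+ M / q ^ m).
  move=> bn ab' Uab; have : (b' - a' %| M)%N.
    by rewrite dvdn_fact // subn_gt0 ab' (leq_trans (leq_subr _ _)).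
  case/dvdnP => e Me; exists (l * e); rewrite Me mulnC exprM -exprz_exp.
  rewrite expfB //.
  by have := unit_ofX Vval e Uab; rewrite expr_div_n.
move=> U'; case: (ltngtP a b) => [lab|lab|/eqP]; last first.
- by rewrite (inj_eq val_inj) (negPf ab).
- by apply: main U' => //; rewrite -ltnS.
- apply: (main a b (s - t)) => //; first by rewrite -ltnS.
  have := unit_ofV U'; rewrite !invf_div mulrC.
  by rewrite -[s - t]opprB -invr_expz invrK.
Qed.

(** This valuation takes the value [F : K]! at p; its values on F^* may all be
    divisible by some d > 1. *)
Let w x : int := xget 0 [set m | unit_of V (x ^+ M / q ^ m)].

Let wP x : x != 0 -> unit_of V (x ^+ M / q ^ w x).
Proof. by move=> /val_power[m Hm]; rewrite /w; case: xgetP => [//|/(_ m)]. Qed.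

Let wE x m : x != 0 -> unit_of V (x ^+ M / q ^ m) -> w x = m.
Proof.
move=> x0 Um; have Uw := wP x0.
have : unit_of V (q ^ (m - w x)).
  have -> : q ^ (m - w x) = x ^+ M / q ^ w x * (x ^+ M / q ^ m)^-1.
    rewrite expfzDr // -invr_expz.
    have xM : x ^+ M != 0 by rewrite expf_neq0.
    have qs : q ^ m != 0 by rewrite expfz_neq0.
    have qt : q ^ w x != 0 by rewrite expfz_neq0.
    move: (x ^+ M) (q ^ m) (q ^ w x) xM qs qt => a b c a0 b0 c0.
    by field; rewrite b0 c0 a0.
  by apply: unit_ofM => //; exact: unit_ofV.
by move/unit_pow/eqP; rewrite subr_eq0 => /eqP.
Qed.

Let wM x y : x != 0 -> y != 0 -> w (x * y) = w x + w y.
Proof.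
move=> x0 y0; apply: wE; first by rewrite mulf_neq0.
have -> : (x * y) ^+ M / q ^ (w x + w y) = x ^+ M / q ^ w x * (y ^+ M / q ^ w y).
  by rewrite expfzDr // exprMn invfM mulrACA.
by apply: unit_ofM => //; exact: wP.
Qed.

Let wV x : x != 0 -> w x^-1 = - w x.
Proof.
move=> x0; apply: wE; rewrite ?invr_eq0 //.
by rewrite exprVn -invr_expz -invfM; apply: unit_ofV; exact: wP.
Qed.

Let wXz x (m : int) : x != 0 -> w (x ^ m) = w x * m.
Proof.
move=> x0; apply: wE; first by rewrite expfz_neq0.
have -> : (x ^ m) ^+ M / q ^ (w x * m) = (x ^+ M / q ^ w x) ^ m.
  rewrite expfzMl; congr (_ * _).
    by rewrite !exprnP !exprz_exp mulrC.
  by rewrite exprz_inv exprz_exp mulrN invr_expz.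
have := wP x0; case: m => m U; first exact: unit_ofX.
by rewrite NegzE -exprnN; apply: unit_ofV; exact: unit_ofX.
Qed.

Let w_ge0 x : x != 0 -> V x <-> 0 <= w x.
Proof.
move=> x0; have pos y : y != 0 -> V y -> 0 <= w y.
  move=> y0 Vy; have := wP y0; case: (w y) => // m [_ _]; rewrite NegzE -exprnN invrK.
  rewrite invfM => H; exfalso; apply: (@powK m.+1) => //.
  have -> : q ^- m.+1 = (y ^+ M)^-1 / q ^+ m.+1 * y ^+ M.
    by rewrite mulrAC mulVf ?mul1r // expf_neq0.
  by apply: subringM => //; exact: subringX.
split=> [|w0]; first exact: pos.
have [//|Vx'] := Vval.2 x; have := pos _ _ Vx'; rewrite invr_eq0 wV // oppr_ge0.
move=> /(_ x0) w0'; have {w0 w0'} w0 : w x = 0 by apply/eqP; rewrite eq_le w0 w0'.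
have := wP x0; rewrite w0 expr0z divr1 => -[_ VxM _].
apply: contrapT => Vx; apply: (@unit_of_max _ _ Vval (x ^- M)).
  by rewrite -exprVn -[x^-1 ^+ M]invrK exprVn invrK; split;
    rewrite ?invr_eq0 ?expf_neq0 ?invrK // -exprVn; exact: subringX.
rewrite -exprVn /M; move: (fact_gt0 (\dim {:F})); case: (_`!) => // m _.
rewrite exprS; apply: max_idealMl => //; last exact: subringX.
by right; rewrite invrK.
Qed.

Let w_q : w q = M%:Z.
Proof.
by apply: wE => //; rewrite -exprnP divff ?expf_neq0 //; exact: unit_of1.
Qed.

(** The value group embeds into Z by w, with p going to [F : K]!; dividing by
    the least positive value d normalises it. *)
Theorem discrete_place : exists P : place F, val_ring P = V.
Proof.
have exd : exists d : nat, `[< (0 < d)%N /\ exists2 x, x != 0 & w x = d >].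
  exists M; apply/asboolP; rewrite fact_gt0; split=> //.
  by exists q; [exact: q0|exact: w_q].
case: (ex_minnP exd) => d /asboolP[d0 [pi pi0 wpi]] dmin.
have d0' : d%:Z != 0 by rewrite -lt0n.
have dvdw x : x != 0 -> w x = (w x %/ d)%Z * d.
  move=> x0; rewrite {1}(divz_eq (w x) d) [X in _ + X](_ : _ = 0) ?addr0 //.
  apply/eqP; rewrite -[_ == 0]negbK; apply/negP => r0.
  have rge : 0 <= (w x %% d)%Z by exact: modz_ge0.
  have /gez0_abs rE := rge.
  have : (d <= `|(w x %% d)%Z|)%N.
    apply: dmin; apply/asboolP; split; first by rewrite absz_gt0.
    exists (x * pi ^ (- (w x %/ d)%Z)); first by rewrite mulf_neq0 ?expfz_neq0.
    rewrite wM ?expfz_neq0 // wXz // wpi rE {1}(divz_eq (w x) d).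
    by rewrite mulrN mulrC addrAC subrr add0r.
  have := ltz_pmod (w x) (_ : 0 < d%:Z); rewrite -rE ltz_nat => /(_ d0).
  by rewrite ltnNge => /negPf ->.
pose v x : int := (w x %/ d)%Z.
have vM x y : x != 0 -> y != 0 -> v (x * y) = v x + v y.
  move=> x0 y0; apply: (mulIf d0'); rewrite -dvdw ?mulf_neq0 // mulrDl -!dvdw //.
  exact: wM.
have v_ge0 x : x != 0 -> V x <-> 0 <= v x.
  move=> x0; rewrite w_ge0 // dvdw // pmulr_lge0 //.
have vXz m : v (pi ^ m) = m by rewrite /v wXz // wpi mulKz.
pose vp x : \bar int := if x == 0 then +oo%E else (v x)%:E%E.
have vpE x : x != 0 -> vp x = (v x)%:E%E by rewrite /vp => /negPf ->.
have vp0 : vp 0 = +oo%E by rewrite /vp eqxx.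
have vpNy x : vp x != -oo%E by rewrite /vp; case: (x == 0).
have f1 : range vp = [set~ -oo%E].
  apply/seteqP; split=> [_ [x _ <-]|]; first by rewrite /vp /=; case: eqP.
  case=> [m _||/(_ erefl)//]; last by exists 0.
  by exists (pi ^ m) => //; rewrite vpE ?expfz_neq0 // vXz.
have f2 x : vp x = +oo%E <-> x = 0 by rewrite /vp; case: eqP.
have f3 x y : vp (x * y) = (vp x + vp y)%E.
  have [->|x0] := eqVneq x 0; first by rewrite mul0r vp0 addye ?vpNy.
  have [->|y0] := eqVneq y 0; first by rewrite mulr0 vp0 addey ?vpNy.
  by rewrite !vpE ?mulf_neq0 // vM.
have f4 x y : (Order.min (vp x) (vp y) <= vp (x + y)%R)%E.
  have H x' y' : x' != 0 -> y' != 0 -> x' + y' != 0 ->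
      v x' <= v y' -> v x' <= v (x' + y').
    move=> x0 y0 xy0 vxy.
    have x'0 : x'^-1 != 0 by rewrite invr_eq0.
    have xx : v x' + v x'^-1 = 0 by rewrite -vM // divff // -(expr0z pi) vXz.
    rewrite -(lerD2r (v x'^-1)) xx -vM // -v_ge0 ?mulf_neq0 // mulrDl divff //.
    apply: subringD => //; first exact: subring1.
    by rewrite v_ge0 ?mulf_neq0 // vM // -xx lerD2r.
  have [->|x0] := eqVneq x 0; first by rewrite add0r ge_min lexx orbT.
  have [->|y0] := eqVneq y 0; first by rewrite addr0 ge_min lexx.
  have [->|xy0] := eqVneq (x + y) 0; first by rewrite vp0 leey.
  rewrite !vpE // ge_min !lee_fin; case: (lerP (v x) (v y)) => [vxy|/ltW vyx].
    by rewrite H.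
  by rewrite addrC H ?orbT // addrC.
have f5 (c : k) : c != 0 -> vp (kscale c 1) = 0%E.
  move=> c0; have cE : kscale c 1 * kscale c^-1 1 = 1 :> F.
    rewrite /kscale -scalerAl mul1r scalerA -tofracM -polyCM divff //.
    by rewrite tofrac1 scale1r.
  have : unit_of V (kscale c 1).
    have nz : kscale c 1 != 0 :> F.
      by apply/eqP => z0; move/eqP: cE; rewrite z0 mul0r eq_sym oner_eq0.
    split=> //; rewrite -[_^-1](_ : kscale c^-1 1 = _) //.
    by apply: (mulfI nz); rewrite cE divff.
  case=> c1 Vc Vc'; rewrite vpE //; congr EFin; apply/eqP; rewrite eq_le.
  move: Vc; rewrite v_ge0 // => ->; rewrite andbT.
  move: Vc'; rewrite v_ge0 ?invr_eq0 // => vc.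
  rewrite -(lerD2r (v (kscale c 1)^-1)) -vM ?invr_eq0 // divff //.
  by rewrite -(expr0z pi) vXz add0r.
exists (Place f1 f2 f3 f4 f5); apply/seteqP; split=> x; rewrite /val_ring /=.
  have [->|x0] := eqVneq x 0; first by move=> _; exact: subring0.
  by rewrite vpE // lee_fin => /(v_ge0 _ x0).
have [->|x0] := eqVneq x 0; first by rewrite vp0.
by rewrite vpE // lee_fin => /(v_ge0 _ x0).
Qed.

End Discrete.

(** * Divisorial ideals of an integral closure *)

Lemma divf_neq0 (K : fieldType) (a b : K) : a != 0 -> b != 0 -> a / b != 0.
Proof. by move=> a0 b0; rewrite mulf_neq0 ?invr_eq0. Qed.

(** F is integral over K and valuation rings are integrally closed. *)
Lemma valuation_ring_full (K : fieldType) (F : fieldExtType K) (V : set F) :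
  valuation_ring V -> (forall x : K, V x%:A) -> V = setT.
Proof.
move=> Vval VK; apply/seteqP; split=> // x _.
have [q q0 rx] := algebraic_relation x.
have lq0 : lead_coef q != 0 by rewrite lead_coef_eq0.
apply: (valuation_ring_integral Vval
  (p := map_poly (in_alg F) ((lead_coef q)^-1 *: q))).
- by apply: monic_map; rewrite monicE lead_coefZ mulVf.
- by move=> i; rewrite coef_map /=; exact: VK.
- by rewrite map_polyZ /= rootZ // scaler_eq0 negb_or oner_eq0 invr_eq0 lq0.
Qed.

(** Divisors are functions on places, so the members of a family are indices
    that have a valuation rather than valuations. *)
Structure valuation_family (E : fieldType) := ValuationFamily {
  vf_index :> Type;
  vf_val : vf_index -> valuation E }.

Coercion vf_val : vf_index >-> valuation.

Section Arithmetic.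
Variables (K : fieldType) (F : fieldExtType K) (T : valuation_family F).
Implicit Types (P Q : T) (x y : F) (A : set K) (cP : set T).

(** The last clause says that p generates the prime of A below P. *)
Definition uniformizer A P (p : K) :=
  [/\ A p, p != 0, (0 < P p%:A)%E &
      forall a, A a -> (0 < P a%:A)%E -> A (a / p)].

Definition base_image A : set F := [set x | exists2 a, A a & x = a%:A].

(** The properties shared by k[t] with the finite places and by the valuation
    ring at infinity with the infinite places. *)
Record place_family A cP : Prop := PlaceFamily {
  pf_subring : subring A;
  pf_inj : forall P Q, cP P -> cP Q -> P =1 Q -> P = Q;
  pf_frac : forall x : K, exists a b, [/\ A a, A b, b != 0 & x = a / b];
  pf_int : forall P a, cP P -> A a -> (0 <= P a%:A)%E;
  pf_unif : forall P, cP P -> exists p, uniformizer A P p;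
  pf_val : forall V : set F, valuation_ring V -> base_image A `<=` V ->
    V <> setT -> exists2 P, cP P & val_ring P = V }.

(** This is deduced, differently for the two families of places, from
    [finite_above], hence from the properties in [place_family]. *)
Definition finite_zeros A cP :=
  forall a, A a -> a != 0 -> finite_set [set P | cP P /\ (0 < P a%:A)%E].

(** It is the integral closure of A in F, by [hol_ring_integral]. *)
Definition hol_ring cP : set F := [set x | forall P, cP P -> (0 <= P x)%E].

Lemma alg_neq0 (a : K) : a != 0 -> a%:A != 0 :> F.
Proof. by move=> a0; rewrite scaler_eq0 negb_or a0 oner_eq0. Qed.

Lemma algM (a b : K) : (a * b)%:A = a%:A * b%:A :> F.
Proof. by rewrite mulr_algl scalerA. Qed.

Lemma alg_div (a b : K) : (a / b)%:A = a%:A / b%:A :> F.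
Proof. exact: (fmorph_div (in_alg F)). Qed.

Lemma base_image_subring A : subring A -> subring (base_image A).
Proof.
move=> Asub; split; first by exists 1; rewrite ?scale1r //; exact: subring1.
  move=> _ _ [a Aa ->] [b Ab ->]; exists (a - b); first exact: subringB.
  by rewrite scalerBl.
move=> _ _ [a Aa ->] [b Ab ->]; exists (a * b); first exact: subringM.
by rewrite algM.
Qed.

Lemma hol_ring_subring cP : subring (hol_ring cP).
Proof.
split=> [P _|x y Ox Oy P cPP|x y Ox Oy P cPP].
- exact: subring1 (val_ring_subring P).
- by apply: (subringB (val_ring_subring P)); [exact: Ox|exact: Oy].
- by apply: (subringM (val_ring_subring P)); [exact: Ox|exact: Oy].
Qed.

Section Family.
Variables (A : set K) (cP : set T).
Hypothesis HA : place_family A cP.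
Let Asub := pf_subring HA.
Local Notation O := (hol_ring cP).

Lemma base_image_hol : base_image A `<=` O.
Proof. by move=> _ [a Aa ->] P cPP; exact: (pf_int HA cPP Aa). Qed.

Lemma common_denominator (I : finType) (c : I -> K) :
  exists d, [/\ A d, d != 0 & forall i, A (d * c i)].
Proof.
have /choice[b Hb] : forall i, exists b, [/\ A b, b != 0 & A (b * c i)].
  move=> i; have [a [b [Aa Ab b0 e]]] := pf_frac HA (c i); exists b; split=> //.
  by rewrite e mulrC mulfVK.
exists (\prod_i b i); split.
- by elim/big_ind: _ => [|u v|i _];
    [exact: subring1 Asub|exact: subringM Asub _ _|case: (Hb i)].
- by apply/prodf_neq0 => i _; case: (Hb i).
- move=> i; rewrite (bigD1 i) //= mulrAC mulrC; apply: (subringM Asub).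
    by elim/big_ind: _ => [|u v|j _];
      [exact: subring1 Asub|exact: subringM Asub _ _|case: (Hb j)].
  by case: (Hb i).
Qed.

(** Dividing by a uniformizer as long as possible makes a vector over K
    primitive at P. *)
Lemma primitive_multiple P (I : finType) (c : I -> K) : cP P ->
  (exists i, c i != 0) ->
  exists d, [/\ d != 0, forall i, A (d * c i) & exists i, P (d * c i)%:A = 0%E].
Proof.
move=> cPP [i0 ci0]; have [p [Ap p0 Pp Adiv]] := pf_unif HA cPP.
have [d0 [Ad0 d00 Hd0]] := common_denominator c.
have main N (d : K) : d != 0 -> (forall i, A (d * c i)) ->
    (absz (vz P (d * c i0)%:A) < N)%N ->
    exists d, [/\ d != 0, forall i, A (d * c i) & exists i, P (d * c i)%:A = 0%E].
  elim: N d => // N IH d dn0 Ad; rewrite ltnS => dN.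
  have [[i Hi]|H] := pselect (exists i, P (d * c i)%:A = 0%E).
    by exists d; split=> //; exists i.
  have pos i : (0 < P (d * c i)%:A)%E.
    rewrite lt_neqAle (pf_int HA cPP (Ad i)) andbT eq_sym.
    by apply/eqP => Hi; apply: H; exists i.
  have dp_neq0 : d / p != 0 by exact: (divf_neq0 dn0 p0).
  apply: (IH (d / p) dp_neq0).
    by move=> i; rewrite mulrAC; exact: Adiv.
  apply: leq_trans dN.
  have dc0 : (d * c i0)%:A != 0 :> F by exact: (alg_neq0 (mulf_neq0 dn0 ci0)).
  have -> : (d * c i0)%:A = (d / p * c i0)%:A * p%:A :> F.
    by rewrite -algM mulrAC mulfVK.
  have dp0 : (d / p * c i0)%:A != 0 :> F by exact: (alg_neq0 (mulf_neq0 dp_neq0 ci0)).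
  have pA0 : p%:A != 0 :> F := alg_neq0 p0.
  rewrite (vzM P dp0 pA0).
  have := pf_int HA cPP (Adiv _ (Ad i0) (pos i0)).
  rewrite mulrAC (vval_vz P dp0) lee_fin.
  move: Pp; rewrite (vval_vz P pA0) lte_fin.
  case: (vz P p%:A) => [[|b]|b] // _; case: (vz P _) => // a _.
  by rewrite -PoszD /= addnS ltnS leq_addr.
exact: (main _ d0 d00 Hd0 (ltnSn _)).
Qed.

(** For a primitive relation sum a_i y^i = 0 the Horner sums
    B_j = sum_(i >= j) a_i y^(i-j) and y B_j are integral: at a place where y
    has a pole, B_j is also - sum_(i < j) a_i y^(i-j).  As
    a_j = B_j - y B_(j+1), some B_j is a unit at P. *)
Lemma localization P y : cP P -> (0 <= P y)%E ->
  exists b, [/\ O b, O (b * y) & P b = 0%E].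
Proof.
move=> cPP Py.
pose m := (\dim {:F}).+1.
have [c [i ci] sc] := @linear_dependence _ F m (fun i : 'I_m => y ^+ i) (ltnSn _).
have [|d [d0 Ad [i1 Pi1]]] := @primitive_multiple P _ c cPP; first by exists i.
pose a (j : nat) : F := if (j < m)%N then (d * c (inord j))%:A else 0.
have Oa j : O (a j).
  rewrite /a; case: ifP => _; last exact: subring0 (hol_ring_subring cP).
  by apply: base_image_hol; exists (d * c (inord j)).
have suma : \sum_(0 <= j < m) a j * y ^+ j = 0.
  transitivity (d *: \sum_(j < m) c j *: y ^+ j); last by rewrite sc scaler0.
  rewrite big_mkord scaler_sumr; apply: eq_bigr => j _.
  by rewrite /a ltn_ord inord_val mulr_algl scalerA.
pose B j := \sum_(j <= l < m) a l * y ^+ (l - j).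
have BS j : (j < m)%N -> B j = a j + B j.+1 * y.
  move=> jm; rewrite /B big_ltn // subnn expr0 mulr1; congr (_ + _).
  rewrite mulr_suml; apply: eq_big_nat => l /andP[jl _].
  by rewrite -mulrA -exprSr -subSn.
have B0 : B 0%N = 0.
  by rewrite -[RHS]suma; apply: eq_bigr => j _; rewrite subn0.
have Bm j : (m <= j)%N -> B j = 0 by move=> mj; rewrite /B big_geq.
have OB j : O (B j).
  move=> Q cPQ; have Qsub := val_ring_subring Q.
  have [Qy|Qy] := pselect (val_ring Q y).
    apply: (subring_sum Qsub) => l _; apply: (subringM Qsub); first exact: Oa.
    exact: subringX.
  have [//|Qy'] := (val_ring_valuation Q).2 y.
  have y0 : y != 0.
    by apply/eqP => y0; apply: Qy; rewrite y0; exact: subring0.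
  have [mj|/ltnW jm] := leqP m j; first by rewrite Bm //; exact: (subring0 Qsub).
  suff -> : B j = - \sum_(0 <= l < j) a l * y^-1 ^+ (j - l).
    apply: (subringN Qsub); apply: (subring_sum Qsub) => l _.
    by apply: (subringM Qsub); [exact: Oa|exact: subringX].
  apply/eqP; rewrite -addr_eq0 -(mulIr_eq0 _ (mulIf (expf_neq0 j y0))); apply/eqP.
  transitivity (\sum_(0 <= l < m) a l * y ^+ l); last exact: suma.
  rewrite [RHS](big_cat_nat (n := j)) //= [RHS]addrC mulrDl !mulr_suml.
  congr (_ + _); apply: eq_big_nat => l /andP[jl lj].
    by rewrite -mulrA -exprD subnK.
  rewrite -mulrA exprVn; congr (_ * _); rewrite mulrC.
  by rewrite -{1}(subnKC (ltnW lj)) exprD mulfK // expf_neq0.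
have [j Bj] : exists j, P (B j) = 0%E.
  apply: contrapT => H.
  have pos j : (0 < P (B j))%E.
    rewrite lt_neqAle (OB j P cPP) andbT eq_sym.
    by apply/eqP => Hi; apply: H; exists j.
  suff : (0 < P (a i1))%E.
    by rewrite /a ltn_ord inord_val Pi1 ltxx.
  have -> : a i1 = B i1 - B i1.+1 * y by rewrite BS // addrK.
  apply: vval_gtD => //; rewrite vvalN; apply/max_ideal_val.
  by apply: max_idealMl; [exact: val_ring_valuation|exact/max_ideal_val|].
have j0 : (0 < j)%N by case: j Bj => //; rewrite B0 vval0.
have jm : (j < m)%N by rewrite ltnNge; apply/negP => /Bm e; move: Bj; rewrite e vval0.
exists (B j); split=> //.
have -> : B j * y = B j.-1 - a j.-1.
  by rewrite [B j.-1]BS ?prednK ?(ltnW jm) // addrC addKr.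
by apply: (subringB (hol_ring_subring cP)).
Qed.

(** Valuation rings of distinct places are not nested; a fraction b'/b with b a
    unit at P that lies in the ring of P but not in that of Q has a
    denominator vanishing at Q. *)
Lemma separate_places P Q : cP P -> cP Q -> P <> Q ->
  exists b, [/\ O b, P b = 0%E & (0 < Q b)%E].
Proof.
move=> cPP cPQ PQ.
have [y Py Qy] : exists2 y, (0 <= P y)%E & ~ (0 <= Q y)%E.
  apply: contrapT => H; apply: PQ; apply: (pf_inj HA) => //.
  apply: val_ring_sub_eq => y Py.
  by apply: contrapT => Qy; apply: H; exists y.
have [b [Ob Oby Pb]] := localization cPP Py; exists b; split=> //.
rewrite lt_neqAle Ob // andbT; apply/eqP => Qb; apply: Qy.
by have := Oby Q cPQ; rewrite vvalM -Qb add0e.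
Qed.

(** Elements that are units at one and vanish at the others of m given places
    over the same prime of A are linearly independent over K. *)
Lemma finite_above (p : K) : finite_set [set P | cP P /\ uniformizer A P p].
Proof.
apply: contrapT => /(@infinite_set_fset {classic T} _ (\dim {:F}).+1)[X XS cX].
set m := #|` X| in cX.
pose f (i : 'I_m) : T := tnth (in_tuple X) i.
have fX i : cP (f i) /\ uniformizer A (f i) p by apply: XS; exact: mem_tnth.
have finj i j : i != j -> f i <> f j.
  have /tuple_uniqP tinj : uniq (in_tuple X) by exact: fset_uniq.
  by move=> ij /tinj e; move: ij; rewrite e eqxx.
have /choice[b Hb] : forall ij : 'I_m * 'I_m, exists b, ij.1 != ij.2 ->
    [/\ O b, f ij.1 b = 0%E & (0 < f ij.2 b)%E].
  move=> [i j]; have [ij|ij] := eqVneq i j; first by exists 0.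
  have [b ?] := separate_places (fX i).1 (fX j).1 (finj _ _ ij).
  by exists b.
pose x i := \prod_(j | i != j) b (i, j).
have xi i : f i (x i) = 0%E.
  by rewrite /x; elim/big_ind: _ => [|u v|j ij];
    [exact: vval1|rewrite vvalM => -> ->; rewrite adde0|case: (Hb (i, j) ij)].
have Ox i : O (x i).
  by rewrite /x; elim/big_ind: _ => [|u v|j ij];
    [exact: subring1 (hol_ring_subring _)|exact: subringM (hol_ring_subring _) _ _
    |case: (Hb (i, j) ij)].
have xij i j : i != j -> max_ideal (val_ring (f j)) (x i).
  move=> ij; rewrite /x (bigD1 j) //=; apply: max_idealMl.
  - exact: val_ring_valuation.
  - by apply/max_ideal_val; case: (Hb (i, j) ij).
  have sub := val_ring_subring (f j).
  elim/big_ind: _ => [|u v|l /andP[il _]]; [exact: subring1|exact: subringM|].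
  by case: (Hb (i, l) il) => + _ _; apply; case: (fX j).
have [c cn sc] := @linear_dependence _ F m x cX.
have [i0 _] := cn; have [cP0 _] := fX i0.
have [d [d0 Ad [i1 Pi1]]] := primitive_multiple cP0 cn.
set y := (d * c i1)%:A in Pi1.
have [cPi [Ap p0 fp Adiv]] := fX i1.
have fy : f i1 y = 0%E.
  apply/eqP; rewrite eq_le (pf_int HA cPi (Ad i1)) andbT leNgt; apply/negP.
  move=> /(Adiv _ (Ad i1)) /(pf_int HA cP0); apply/negP; rewrite -ltNge.
  have y0 : y != 0 by apply/eqP => y0; move: Pi1; rewrite y0 vval0.
  have [_ [_ _ f0p _]] := fX i0.
  have yp0 : (d * c i1 / p)%:A != 0 :> F.
    apply/eqP => /eqP.
    by rewrite algM mulf_eq0 (negPf y0) /= (negPf (alg_neq0 _)) // invr_eq0.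
  have ye : y = (d * c i1 / p)%:A * p%:A by rewrite -algM mulfVK.
  move: Pi1 f0p; rewrite ye vvalM (vval_vz _ yp0) (vval_vz _ (alg_neq0 p0)) => -[e].
  by rewrite !lte_fin -(ltrD2r (vz (f i0) p%:A) _ 0) e add0r.
have sum0 : \sum_i (d * c i)%:A * x i = 0.
  transitivity (d *: \sum_j c j *: x j); last by rewrite sc scaler0.
  rewrite scaler_sumr; apply: eq_bigr => j _.
  by rewrite mulr_algl scalerA.
have : max_ideal (val_ring (f i1)) (y * x i1).
  move: sum0; rewrite (bigD1 i1) //= => /eqP; rewrite addr_eq0 => /eqP ->.
  rewrite -mulN1r mulrC; apply: max_idealMl; first exact: val_ring_valuation.
    apply: max_ideal_sum; first exact: val_ring_valuation.
    move=> j ji; rewrite mulrC; apply: max_idealMl; first exact: val_ring_valuation.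
      exact: xij.
    exact: (pf_int HA cPi (Ad j)).
  have sub := val_ring_subring (f i1).
  by apply: (subringN sub); exact: subring1.
by move/max_ideal_val; rewrite vvalM fy xi adde0 ltxx.
Qed.

(** If x is not integral over A then x^-1 generates a proper ideal of A[x^-1],
    and Chevalley's theorem gives a place of the family at which x has a
    pole. *)
Lemma hol_ring_integral :
  [set x : F | exists p : {poly K}, [/\ p \is monic, forall i, A p`_i &
    root (map_poly (in_alg F) p) x]] = O.
Proof.
apply/seteqP; split=> [x [p [pm Ap px]] P cPP|x Ox].
  apply: (valuation_ring_integral (val_ring_valuation P) _ _ px).
    exact: monic_map.
  by move=> i; rewrite coef_map /=; exact: (pf_int HA cPP (Ap i)).
have [->|x0] := eqVneq x 0.
  exists 'X; split; [exact: monicX| |by rewrite map_polyX rootX].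
  by move=> i; rewrite coefX; case: eqP => _; [exact: subring1|exact: subring0].
have Bsub := base_image_subring Asub.
apply: contrapT => nint.
have Rsub := adjoin_subring x^-1 Bsub.
have [| |V [Vval RV JV]] := @chevalley _ (adjoin (base_image A) x^-1) [set x^-1] Rsub.
- by move=> _ ->; exact: mem_adjoin.
- move=> H; apply: nint.
  have [_ [q Aq ->] e] := span_mul_principal Rsub H.
  have /choice[a Ha] : forall i, exists a, A a /\ q`_i = a%:A.
    by move=> i; have [a Aa ->] := Aq i; exists a.
  set m := size q.
  pose r := \poly_(i < m) a (m - i.+1)%N.
  have sr : (size (- r) < size ('X^m : {poly K}))%N.
    by rewrite size_polyN size_polyXn ltnS; exact: size_poly.
  exists ('X^m - r); split.
  - by rewrite monicE lead_coefDl // lead_coefXn.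
  - move=> i; rewrite coefB coefXn coef_poly; apply: (subringB Asub).
      by case: eqP => _; [exact: subring1|exact: subring0].
    by case: ifP => _; [case: (Ha (m - i.+1)%N)|exact: subring0].
  - apply/rootP; rewrite rmorphB /= map_polyXn hornerD hornerXn hornerN.
    apply/eqP; rewrite subr_eq0 -[x ^+ m]mulr1 e horner_coef -/m.
    rewrite (@horner_coef_wide _ m); last first.
      by rewrite size_map_poly; exact: size_poly.
    rewrite (reindex_inj rev_ord_inj) /= !mulr_sumr; apply/eqP; apply: eq_bigr => i _.
    have im := ltn_ord i; rewrite coef_map coef_poly im /=.
    have [_ <-] := Ha (m - i.+1)%N.
    transitivity (q`_(m - i.+1) * (x ^+ m * x^-1 ^+ (m - i))).
      by rewrite -(subnSK im) exprS; ring.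
    congr (_ * _); rewrite exprVn.
    by rewrite -{1}(subnKC (ltnW im)) exprD mulfK // expf_neq0.
have Vx : ~ V x.
  by have [/eqP|] := JV _ erefl; rewrite ?invr_eq0 ?(negPf x0) // invrK.
have [|V1|P cPP VP] := pf_val HA Vval.
- by apply: subset_trans RV; exact: sub_adjoin.
- by apply: Vx; rewrite V1.
- by apply: Vx; rewrite -VP; exact: Ox.
Qed.

End Family.

End Arithmetic.

Section Divisorial.
Variables (K : fieldType) (F : fieldExtType K) (T : valuation_family F).
Implicit Types (P Q : T) (x y : F) (D : T -> int).
Variables (A : set K) (cP : set T).
Hypothesis HA : place_family A cP.
Hypothesis Afin : finite_zeros A cP.
Local Notation O := (hol_ring cP).

Definition divisorial (cP : set T) D : set F :=
  [set x | forall P, cP P -> ((D P)%:E <= P x)%E].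

Definition finite_support_on (cP : set T) D :=
  finite_set [set P | cP P /\ D P != 0].

(** A pole of x is a zero of a common denominator of the coefficients of a
    monic equation of x. *)
Lemma finite_poles x : finite_set [set P | cP P /\ ~ (0 <= P x)%E].
Proof.
have [q q0 rx] := algebraic_relation x.
pose q' := (lead_coef q)^-1 *: q.
have lq0 : lead_coef q != 0 by rewrite lead_coef_eq0.
have q'm : q' \is monic by rewrite monicE lead_coefZ mulVf.
have [d [Ad d0 Hd]] := common_denominator HA (fun i : 'I_(size q') => q'`_i).
apply: sub_finite_set (Afin Ad d0) => P [cPP Px]; split=> //.
rewrite lt_neqAle (pf_int HA cPP Ad) andbT; apply/eqP => Pd; apply: Px.
apply: (valuation_ring_integral (val_ring_valuation P) (p := map_poly (in_alg F) q')).
- exact: monic_map.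
- move=> i; rewrite coef_map /=; have [iq|iq] := ltnP i (size q'); last first.
    by rewrite nth_default // scale0r; exact: subring0 (val_ring_subring P).
  by have := pf_int HA cPP (Hd (Ordinal iq)); rewrite algM vvalM -Pd add0e.
- by rewrite map_polyZ /= rootZ // alg_neq0 // invr_eq0.
Qed.

Lemma vz_prod P (I : Type) (s : seq I) (f : I -> F) : (forall i, f i != 0) ->
  vz P (\prod_(i <- s) f i) = \sum_(i <- s) vz P (f i).
Proof.
move=> f0; elim: s => [|i s IH]; first by rewrite !big_nil vz1.
by rewrite !big_cons vzM ?IH //; elim/big_ind: _ => // *; rewrite ?oner_neq0 ?mulf_neq0.
Qed.

(** Starting from an element with the right value at P, multiply by powers of
    units at P vanishing at the finitely many places where it is too small. *)
Lemma divisorial_exact D P : finite_support_on cP D -> cP P ->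
  exists x, [/\ x != 0, divisorial cP D x & vz P x = D P].
Proof.
move=> Dfin cPP; have [pi pi0 vpi] := vval_unif P (D P).
pose Z : set {classic T} := [set Q : T | cP Q /\ vz Q pi < D Q].
have Zfin : finite_set Z.
  apply: sub_finite_set (_ : finite_set (_ `|` _)); last first.
    by rewrite finite_setU; split; [exact: Dfin|exact: finite_poles pi].
  move=> Q [cPQ piD]; have [D0|D0] := eqVneq (D Q) 0; [right|by left].
  by split=> //; rewrite vval_vz // lee_fin -D0; apply/negP; rewrite -ltNge.
have /choice[b Hb] : forall Q, exists b,
    [/\ b != 0, O b, vz P b = 0 & cP Q -> Q <> P -> 0 < vz Q b].
  move=> Q; have [[cPQ QP]|H] := pselect (cP Q /\ Q <> P); last first.
    exists 1; rewrite oner_neq0 vz1; split=> //; last by move=> ? ?; case: H.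
    exact: subring1 (hol_ring_subring cP).
  have [b [Ob Pb Qb]] := separate_places HA cPP cPQ (nesym QP).
  have b0 : b != 0 by apply/eqP => b0; move: Pb; rewrite b0 vval0.
  exists b; split=> //; first by move: Pb; rewrite vval_vz // => -[].
  by move=> _ _; move: Qb; rewrite vval_vz.
have b0 Q : b Q != 0 by case: (Hb Q).
pose e Q := absz (D Q - vz Q pi).
pose s := \prod_(Q <- fset_set Z) b Q ^+ e Q.
have s0 : s != 0.
  by rewrite /s; elim/big_ind: _ => // *; rewrite ?oner_neq0 ?mulf_neq0 ?expf_neq0.
have vs (R : T) : vz R s = \sum_(Q <- fset_set Z) vz R (b Q) *+ e Q.
  rewrite /s vz_prod => [|Q]; last exact: expf_neq0.
  by apply: eq_bigr => Q _; rewrite vzX.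
have vb (R Q : T) : cP R -> 0 <= vz R (b Q).
  by move=> cPR; have [_ /(_ R cPR)] := Hb Q; rewrite vval_vz // lee_fin.
exists (pi * s); split; first by rewrite mulf_neq0.
- move=> Q cPQ; rewrite vval_ge ?mulf_neq0 // vzM // vs.
  have [ZQ|ZQ] := pselect (Z Q); last first.
    have DQ : D Q <= vz Q pi by rewrite leNgt; apply/negP => h; apply: ZQ.
    rewrite -[D Q]addr0 lerD // sumr_ge0 // => R _.
    by rewrite mulrn_wge0 // vb.
  rewrite (bigD1_seq (Q : {classic T})) ?fset_uniq ?in_fset_set ?inE //=.
  have QP : Q <> P by move=> QP; case: ZQ; rewrite QP vpi ltxx.
  have eQ : (e Q)%:Z = D Q - vz Q pi.
    by rewrite /e gez0_abs // subr_ge0 ltW //; case: ZQ.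
  have : (e Q)%:Z <= vz Q (b Q) *+ e Q.
    rewrite -mulr_natl natz ler_peMr //.
    by have [_ _ _ /(_ cPQ QP)] := Hb Q; rewrite -gtz0_ge1.
  rewrite eQ lerBlDl => /le_trans; apply; rewrite addrA lerDl.
  by apply: sumr_ge0 => R _; rewrite mulrn_wge0 // vb.
- rewrite vzM // vpi vs big1 ?addr0 // => Q _.
  by case: (Hb Q) => _ _ -> _; rewrite mul0rn.
Qed.

Lemma divisorial_nonzero D : finite_support_on cP D ->
  exists2 x, x != 0 & divisorial cP D x.
Proof.
move=> Dfin; have [[P cPP]|H] := pselect (exists P, cP P).
  by have [x [x0 Dx _]] := divisorial_exact Dfin cPP; exists x.
by exists 1; [exact: oner_neq0|move=> P cPP; case: H; exists P].
Qed.

Lemma finite_supportN D : finite_support_on cP D ->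
  finite_support_on cP (fun P => - D P).
Proof.
by apply: sub_finite_set => P [cPP]; rewrite oppr_eq0.
Qed.

Lemma divisorial_mem D E x y : divisorial cP D x -> divisorial cP E y ->
  divisorial cP (fun P => D P + E P) (x * y).
Proof.
by move=> Dx Ey P cPP; rewrite vvalM EFinD leeD //; [exact: Dx|exact: Ey].
Qed.

Lemma divisorial_add D x y : divisorial cP D x -> divisorial cP D y ->
  divisorial cP D (x + y).
Proof. by move=> Dx Dy P cPP; apply: vval_geD; [exact: Dx|exact: Dy]. Qed.

Lemma divisorial0 D : divisorial cP D 0.
Proof. by move=> P _; rewrite vval0 leey. Qed.

Lemma divisorial_mul_sub D E : span_mul (divisorial cP D) (divisorial cP E) `<=`
  divisorial cP (fun P => D P + E P).
Proof.
apply: span_mul_ind; [exact: divisorial0|exact: divisorial_add|].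
by move=> x y; exact: divisorial_mem.
Qed.

(** If I(D) I(-D) were a proper ideal, Chevalley's theorem would produce a
    place of the family at which all its elements vanish, whereas elements of
    exact value D P and - D P have a product that is a unit at P. *)
Lemma divisorial_invertible D : finite_support_on cP D ->
  span_mul (divisorial cP D) (divisorial cP (fun P => - D P)) 1.
Proof.
move=> Dfin; have Nfin := finite_supportN Dfin.
set J := span_mul _ _; apply: contrapT => J1.
have Osub := hol_ring_subring cP.
have JO : J `<=` O.
  move=> x /divisorial_mul_sub Jx P /Jx /=; by rewrite subrr.
have JJ : span_mul J O `<=` J.
  apply: span_mul_ind; [exact: span_mul0|exact: span_mulD|].
  move=> x y + Oy; move: x; apply: (@span_mul_ind _ _ _ (fun x => J (x * y))).
  - by rewrite mul0r; exact: span_mul0.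
  - by move=> u v Ju Jv; rewrite mulrDl; exact: span_mulD.
  - move=> u v Du Ev; rewrite -mulrA; apply: span_mul_mem => //.
    move=> P cPP; have := divisorial_mem Ev (_ : divisorial cP (fun=> 0) y).
    by move=> /(_ Oy P cPP); rewrite addr0.
have [|V [Vval OV JV]] := chevalley Osub JO; first by move/JJ.
have [|V1|P cPP VP] := pf_val HA Vval.
- by apply: subset_trans OV; exact: base_image_hol.
- have [x x0 Dx] := divisorial_nonzero Dfin.
  have [y y0 Ey] := divisorial_nonzero Nfin.
  have [/eqP|] := JV _ (span_mul_mem Dx Ey); last by apply; rewrite V1.
  by rewrite mulf_eq0 (negPf x0) (negPf y0).
- have [x [x0 Dx vx]] := divisorial_exact Dfin cPP.
  have [y [y0 Ey vy]] := divisorial_exact Nfin cPP.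
  have := JV _ (span_mul_mem Dx Ey); rewrite -VP => /max_ideal_val.
  by rewrite vval_vz ?mulf_neq0 // vzM // vx vy subrr ltxx.
Qed.

(** As I(D) I(-D) contains 1, an element z of I(D + E) is a sum of products
    x (y z) with x in I(D) and y in I(-D). *)
Lemma divisorial_mul D E : finite_support_on cP D ->
  span_mul (divisorial cP D) (divisorial cP E) = divisorial cP (fun P => D P + E P).
Proof.
move=> Dfin; apply/seteqP; split; first exact: divisorial_mul_sub.
move=> z DEz; rewrite -[z]mul1r.
suff H x : span_mul (divisorial cP D) (divisorial cP (fun P => - D P)) x ->
    span_mul (divisorial cP D) (divisorial cP E) (x * z).
  exact: H (divisorial_invertible Dfin).
move: x; apply: span_mul_ind.
- by rewrite mul0r; exact: span_mul0.
- by move=> x y Hx Hy; rewrite mulrDl; exact: span_mulD.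
- move=> x y Dx Dy; rewrite -mulrA; apply: span_mul_mem => // P cPP.
  by have := divisorial_mem Dy DEz cPP; rewrite addrA addNr add0r.
Qed.

Lemma divisorial_eq D E : finite_support_on cP D -> finite_support_on cP E ->
  divisorial cP D = divisorial cP E -> forall P, cP P -> D P = E P.
Proof.
have H D' E' : finite_support_on cP D' -> divisorial cP D' `<=` divisorial cP E' ->
    forall P, cP P -> E' P <= D' P.
  move=> Dfin DE P cPP; have [x [x0 Dx <-]] := divisorial_exact Dfin cPP.
  by rewrite -vval_ge //; exact: DE.
by move=> Dfin Efin DE P cPP; apply/eqP; rewrite eq_le !H // DE.
Qed.

(** Multiplying by the elements of exact value D P bounds x at P. *)
Lemma divisorial_inv D : finite_support_on cP D ->
  [set x | forall y, divisorial cP D y -> O (x * y)] = divisorial cP (fun P => - D P).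
Proof.
move=> Dfin; apply/seteqP; split=> x; last first.
  by move=> Dx y Dy P cPP; have := divisorial_mem Dx Dy cPP; rewrite addNr.
move=> Hx P cPP; have [->|x0] := eqVneq x 0; first by rewrite vval0 leey.
have [y [y0 Dy vy]] := divisorial_exact Dfin cPP.
have := Hx _ Dy P cPP.
by rewrite !vval_vz ?mulf_neq0 // vzM // vy !lee_fin -lerBlDr sub0r.
Qed.

Definition single P (m : int) : T -> int := fun Q => if `[< Q = P >] then m else 0.

Lemma single_diag P m : single P m P = m.
Proof. by rewrite /single asboolT. Qed.

Lemma singleN P m : (fun Q => - single P m Q) = single P (- m).
Proof. by apply/funext => Q; rewrite /single; case: asboolP; rewrite ?oppr0. Qed.

Lemma singleMn P m j : (fun Q => single P m Q *+ j) = single P (m *+ j).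
Proof. by apply/funext => Q; rewrite /single; case: asboolP; rewrite ?mul0rn. Qed.

Lemma single0 P : single P 0 = (fun=> 0).
Proof. by apply/funext => Q; rewrite /single; case: asboolP. Qed.

Lemma single_finite P m : finite_support_on cP (single P m).
Proof.
apply: sub_finite_set (finite_set1 P) => Q [_]; rewrite /single.
by case: asboolP => //; rewrite eqxx.
Qed.

Lemma vanishing_ideal_divisorial P : cP P ->
  [set x | O x /\ (0 < P x)%E] = divisorial cP (single P 1).
Proof.
move=> cPP; apply/seteqP; split=> x.
  move=> [Ox Px] Q cPQ; rewrite /single; case: asboolP => [->|_]; last exact: Ox.
  have [->|x0] := eqVneq x 0; first by rewrite vval0 leey.
  by move: Px; rewrite vval_vz // lte_fin lee_fin gtz0_ge1.
move=> Dx; split=> [Q cPQ|].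
  by apply: le_trans (Dx Q cPQ); rewrite /single lee_fin; case: asboolP.
by apply: lt_le_trans (Dx P cPP); rewrite single_diag lte_fin.
Qed.

Lemma iter_divisorial D m : finite_support_on cP D ->
  iter m (span_mul (divisorial cP D)) O = divisorial cP (fun P => D P *+ m).
Proof.
move=> Dfin; elim: m => [|m IH] //; rewrite iterS IH divisorial_mul //.
by congr divisorial; apply/funext => P; rewrite mulrS.
Qed.

End Divisorial.

Section IdealProducts.
Variables (k : fieldType) (F : fieldExtType {fraction {poly k}}).
Local Notation K := {fraction {poly k}}.

Canonical places := ValuationFamily (@place_valuation k F).

Variables (A : set K) (cP : set (place F)).
Hypothesis HA : place_family A (cP : set places).
Hypothesis Afin : finite_zeros A (cP : set places).
Local Notation O := (@hol_ring K F places cP).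
Local Notation divis := (@divisorial K F places cP).
Local Notation fsupp := (@finite_support_on K F places cP).
Implicit Types (P Q : place F) (D : place F -> int).

Lemma fid_exp_divisorial P (m : int) : cP P ->
  fid_exp O (prime_of O P) m = divis (single (P : places) m).
Proof.
move=> cPP; have -> : prime_of O P = divis (single (P : places) 1).
  exact: (@vanishing_ideal_divisorial K F places cP P cPP).
have fin := @single_finite K F places cP P 1.
case: m => m; rewrite /fid_exp.
  rewrite [LHS](iter_divisorial HA Afin m fin) singleMn; congr (divis (single _ _)).
  by rewrite pmulrn intz.
have -> : fid_inv O (divis (single (P : places) 1)) = divis (single (P : places) (-1)).
  by rewrite -singleN; exact: (divisorial_inv HA Afin fin).
rewrite [LHS](iter_divisorial HA Afin _ (@single_finite K F places cP P (-1))) singleMn.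
by congr (divis (single _ _)); rewrite mulNrn NegzE pmulrn intz.
Qed.

(** The places whose factor is trivial, which the iterated product skips, are
    those with exponent 0, by [divisorial_eq]. *)
Lemma prod_divisorial D : fsupp D ->
  \big[(@fid_mul k F)/O]_(P \in cP) fid_exp O (prime_of O P) (D P) = divis D.
Proof.
move=> Dfin; set f := fun P => fid_exp O (prime_of O P) (D P).
have suppE P : cP P -> f P = O <-> D P = 0.
  move=> cPP; rewrite /f fid_exp_divisorial //; split=> [|->]; last by rewrite single0.
  move/(divisorial_eq HA Afin (@single_finite K F places cP P (D P))
    (_ : fsupp (fun=> 0))) => H.
  have := H _ P cPP; rewrite single_diag; apply.
  by apply: sub_finite_set (finite_set0 _) => Q [_]; rewrite eqxx.
have fin : finite_set (cP `&` f @^-1` [set~ O]).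
  apply: sub_finite_set Dfin => P [cPP fP]; split=> //; apply/eqP => DP.
  by apply: fP; apply/(suppE P).
pose restr (s : seq (place F)) P := if P \in s then D P else 0.
have main (s : seq (place F)) : uniq s -> (forall P, P \in s -> cP P) ->
    \big[(@fid_mul k F)/O]_(P <- s) f P = divis (restr s).
  elim: s => [_ _|P s IH /= /andP[Ps us] sP]; first by rewrite big_nil.
  have cPP : cP P by apply: sP; rewrite mem_head.
  rewrite big_cons IH // => [|Q Qs]; last by apply: sP; rewrite inE Qs orbT.
  rewrite /f fid_exp_divisorial //.
  rewrite [LHS](divisorial_mul HA Afin _ (@single_finite K F places cP P (D P))).
  congr divis; apply/funext => Q; rewrite /single /restr inE.
  case: asboolP => [->|QP]; first by rewrite eqxx (negPf Ps) addr0.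
  by rewrite (negPf (introN eqP QP)) add0r.
rewrite (main (finite_support O cP f)) ?finite_support_uniq // => [|P]; last first.
  by rewrite in_finite_support // inE => -[].
apply/seteqP; split=> x Hx P cPP; have := Hx P cPP;
  rewrite /restr in_finite_support //; case: ifP => // /negP nP;
  suff -> : D P = 0 by [].
  by apply/(suppE P cPP); apply: contrapT => fP; apply: nP; rewrite inE.
by apply/(suppE P cPP); apply: contrapT => fP; apply: nP; rewrite inE.
Qed.

End IdealProducts.

(** * Degrees of rational functions *)

Section RationalFunctionDegree.
Variable k : fieldType.
Local Notation K := {fraction {poly k}}.
Implicit Types (a b c d : {poly k}) (x y : K).

Lemma tofrac_neq0 a : a != 0 -> tofrac a != 0 :> K.
Proof. by rewrite tofrac_eq0. Qed.

Lemma frac_repr x : x = tofrac (frac (repr x)).1 / tofrac (frac (repr x)).2.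
Proof.
have dx := denom_ratioP (repr x); apply: (canRL (mulfK (tofrac_neq0 dx))).
rewrite -{1}[x]reprK; unlock FracField.tofrac; rewrite -[LHS]FracField.pi_mul.
apply/eqmodP => /=; rewrite /FracField.equivf /FracField.mulf.
by rewrite !numden_Ratio ?mulf_neq0 ?oner_eq0 //= !mulr1 mulrC.
Qed.

Lemma frac_eq a b c d : b != 0 -> d != 0 ->
  tofrac a / tofrac b = tofrac c / tofrac d :> K -> a * d = c * b.
Proof.
move=> b0 d0 /eqP; rewrite eqr_div ?tofrac_neq0 // -!tofracM tofrac_eq.
by move/eqP.
Qed.

Lemma degK_frac a b : a != 0 -> b != 0 ->
  degK (tofrac a / tofrac b : K) = ((size a)%:Z - (size b)%:Z)%:E%E.
Proof.
move=> a0 b0; set x : K := _ / _; have x0 : x != 0 by rewrite divf_neq0 ?tofrac_neq0.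
rewrite /degK (negPf x0); have := frac_repr x.
have dx := denom_ratioP (repr x); move: (frac (repr x)) dx => [c d] /= d0 e.
have c0 : c != 0.
  by apply: contraNneq x0 => c0; rewrite e c0 tofrac0 mul0r.
have := frac_eq b0 d0 e => /(congr1 (size : {poly k} -> nat)).
rewrite !size_mul // => ecd; congr EFin.
apply/eqP; rewrite subr_eq addrAC eq_sym subr_eq -!PoszD eqz_nat.
rewrite -(prednK (_ : 0 < size a + size d)%N) ?ecd.
  by rewrite prednK // addn_gt0 size_poly_gt0 c0.
by rewrite addn_gt0 size_poly_gt0 a0.
Qed.

Lemma fracP x : exists a b, b != 0 /\ x = tofrac a / tofrac b.
Proof.
exists (frac (repr x)).1, (frac (repr x)).2; split; [exact: denom_ratioP|exact: frac_repr].
Qed.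

Lemma degK0 : degK (0 : K) = -oo%E. Proof. by rewrite /degK eqxx. Qed.

Lemma A_inftyP x : A_infty x <->
  exists a b, [/\ b != 0, (size a <= size b)%N & x = tofrac a / tofrac b].
Proof.
have [->|x0] := eqVneq x 0.
  split=> _; last by rewrite /A_infty /= degK0.
  by exists 0, 1; rewrite oner_neq0 size_poly0 tofrac0 mul0r.
have x0' a b : x = tofrac a / tofrac b -> a != 0.
  by move=> e; apply: contraNneq x0 => a0; rewrite e a0 tofrac0 mul0r.
split=> [|[a [b [b0 ab e]]]]; last first.
  by rewrite /A_infty /= e degK_frac ?(x0' a b e) // lee_fin subr_le0.
have [a [b [b0 e]]] := fracP x; rewrite /A_infty /= e degK_frac ?(x0' a b e) //.
by rewrite lee_fin subr_le0 => ab; exists a, b.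
Qed.

Lemma P_inftyP x : P_infty x <->
  exists a b, [/\ b != 0, (size a < size b)%N & x = tofrac a / tofrac b].
Proof.
have [->|x0] := eqVneq x 0.
  split=> _; last by rewrite /P_infty /= degK0.
  by exists 0, 1; rewrite oner_neq0 size_poly0 size_poly1 tofrac0 mul0r.
have x0' a b : x = tofrac a / tofrac b -> a != 0.
  by move=> e; apply: contraNneq x0 => a0; rewrite e a0 tofrac0 mul0r.
split=> [|[a [b [b0 ab e]]]]; last first.
  by rewrite /P_infty /= e degK_frac ?(x0' a b e) // lte_fin subr_lt0.
have [a [b [b0 e]]] := fracP x; rewrite /P_infty /= e degK_frac ?(x0' a b e) //.
by rewrite lte_fin subr_lt0 => ab; exists a, b.
Qed.

Lemma A_infty_subring : subring (@A_infty k).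
Proof.
split=> [|x y|x y].
- by apply/A_inftyP; exists 1, 1; rewrite oner_neq0 tofrac1 divr1.
- move=> /A_inftyP[a [b [b0 ab ->]]] /A_inftyP[c [d [d0 cd ->]]]; apply/A_inftyP.
  exists (a * d - c * b), (b * d); rewrite mulf_neq0 //; split=> //.
    apply: leq_trans (size_polyD _ _) _;
    rewrite size_polyN geq_max [size (b * d)]size_mul //.
    apply/andP; split; apply: leq_trans (size_polyMleq _ _) _.
      by rewrite -!subn1 leq_sub2r // leq_add2r.
    by rewrite -!subn1 leq_sub2r // addnC leq_add2l.
  by rewrite -mulNr addf_div ?tofrac_neq0 // mulNr tofracB !tofracM.
- move=> /A_inftyP[a [b [b0 ab ->]]] /A_inftyP[c [d [d0 cd ->]]]; apply/A_inftyP.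
  exists (a * c), (b * d); rewrite mulf_neq0 //; split=> //.
    apply: leq_trans (size_polyMleq _ _) _; rewrite size_mul //.
    by rewrite -!subn1 leq_sub2r // leq_add.
  by rewrite !tofracM mulf_div.
Qed.

Lemma A_infty_frac x : exists a b : K, [/\ A_infty a, A_infty b, b != 0 & x = a / b].
Proof.
have [a [b [b0 e]]] := fracP x.
have one : A_infty (1 : K) by exact: subring1 A_infty_subring.
have [ab|/ltnW ba] := leqP (size a) (size b).
  by exists x, 1; rewrite oner_neq0 divr1; split=> //; apply/A_inftyP; exists a, b.
have [a0|a0] := eqVneq a 0.
  exists 0, 1; rewrite oner_neq0 mul0r e a0 tofrac0 mul0r; split=> //.
  exact: subring0 A_infty_subring.
exists 1, x^-1; rewrite invr_eq0 e invf_div divf_neq0 ?tofrac_neq0 //; split=> //.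
  by apply/A_inftyP; exists b, a.
by rewrite mul1r invf_div.
Qed.

Lemma polyK_subring : subring (@polyK k).
Proof.
split=> [|_ _ [a _ <-] [b _ <-]|_ _ [a _ <-] [b _ <-]].
- by exists 1; rewrite ?tofrac1.
- by exists (a - b); rewrite ?tofracB.
- by exists (a * b); rewrite ?tofracM.
Qed.

Lemma polyK_frac x : exists a b : K, [/\ polyK a, polyK b, b != 0 & x = a / b].
Proof.
have [a [b [b0 ->]]] := fracP x; exists (tofrac a), (tofrac b).
by rewrite tofrac_neq0 //; split=> //; [exists a|exists b].
Qed.

End RationalFunctionDegree.

(** * The two families of places of a function field *)

Section FunctionFieldPlaces.
Variables (k : fieldType) (F : fieldExtType {fraction {poly k}}).
Local Notation K := {fraction {poly k}}.
Local Notation t := (tF F).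
Implicit Types (a b p q : {poly k}) (x : K) (P Q : place F) (V : set F).

Definition poly_image a : F := (tofrac a)%:A.
Local Notation im := poly_image.

Lemma poly_imageM a b : im (a * b) = im a * im b.
Proof. by rewrite /im tofracM algM. Qed.

Lemma poly_imageD a b : im (a + b) = im a + im b.
Proof. by rewrite /im tofracD scalerDl. Qed.

Lemma poly_image1 : im 1 = 1.
Proof. by rewrite /im tofrac1 scale1r. Qed.

Lemma poly_image0 : im 0 = 0.
Proof. by rewrite /im tofrac0 scale0r. Qed.

Lemma poly_image_neq0 a : a != 0 -> im a != 0.
Proof. by move=> a0; exact: (alg_neq0 F (tofrac_neq0 a0)). Qed.

Lemma poly_imageX m : im 'X^m = t ^+ m.
Proof.
elim: m => [|m IH]; first by rewrite !expr0 poly_image1.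
by rewrite !exprS poly_imageM IH.
Qed.

Lemma poly_image_sum a : im a = \sum_(i < size a) kscale a`_i 1 * t ^+ i.
Proof.
have sumE (I : Type) (s : seq I) (f : I -> {poly k}) :
    im (\sum_(i <- s) f i) = \sum_(i <- s) im (f i).
  elim: s => [|i s IH]; first by rewrite !big_nil poly_image0.
  by rewrite !big_cons poly_imageD IH.
rewrite -[X in im X]coefK poly_def sumE; apply: eq_bigr => i _.
by rewrite -mul_polyC poly_imageM poly_imageX.
Qed.

Lemma frac_alg a b : (tofrac a / tofrac b)%:A = im a / im b.
Proof. exact: alg_div. Qed.

Lemma alg_frac x : exists a b, b != 0 /\ x%:A = im a / im b.
Proof. by have [a [b [b0 ->]]] := fracP x; exists a, b; rewrite frac_alg. Qed.

Lemma t_neq0 : t != 0.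
Proof. by apply: poly_image_neq0; rewrite polyX_eq0. Qed.

Lemma kscale_unit (c : k) : c != 0 -> kscale c 1 * kscale c^-1 1 = 1 :> F.
Proof.
move=> c0; rewrite -[kscale c 1]/(im c%:P) -[kscale _ 1]/(im c^-1%:P) -poly_imageM.
by rewrite -polyCM divff // poly_image1.
Qed.

Section OverConstants.
Variable V : set F.
Hypothesis Vval : valuation_ring V.
Hypothesis Vk : forall c : k, V (kscale c 1).
Let Vsub : subring V := Vval.1.

Lemma const_unit (c : k) : c != 0 -> unit_of V (kscale c 1).
Proof.
move=> c0; have e := kscale_unit c0; have nz : kscale c 1 != 0 :> F.
  by apply/eqP => z; move/eqP: e; rewrite z mul0r eq_sym oner_eq0.
split=> //; suff -> : (kscale c 1)^-1 = kscale c^-1 1 :> F by [].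
by apply: (mulfI nz); rewrite e divff.
Qed.

Lemma unit_of_addmax (x y : F) : unit_of V x -> max_ideal V y -> unit_of V (x + y).
Proof.
move=> Ux ym; have Vxy : V (x + y).
  by apply: subringD => //; [case: Ux|exact: max_ideal_sub].
have nm : ~ max_ideal V (x + y).
  move=> xym; apply: (unit_of_max Vval Ux); rewrite -[x](addrK y).
  apply: max_idealD => //; rewrite -mulN1r mulrC; apply: max_idealMl => //.
  by apply: subringN => //; exact: subring1.
by apply: max_ideal_unit => //; apply/eqP => xy; apply: nm; left.
Qed.

Lemma poly_image_sub a : V t -> V (im a).
Proof.
move=> Vt; rewrite poly_image_sum; apply: subring_sum => // i _.
by apply: subringM => //; exact: subringX.
Qed.

(** If t has a pole, the leading term dominates every polynomial. *)
Lemma poly_image_pole a : ~ V t -> a != 0 -> unit_of V (im a / t ^+ (size a).-1).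
Proof.
move=> Vt a0; have sm : max_ideal V t^-1 by right; rewrite invrK.
have sa : (0 < size a)%N by rewrite size_poly_gt0.
rewrite poly_image_sum; move: (lead_coef_eq0 a); rewrite /lead_coef (negPf a0).
case: (size a) sa => //= m _ lc.
rewrite big_ord_recr mulrDl addrC /=; apply: unit_of_addmax.
  rewrite mulfK ?expf_neq0 ?t_neq0 //; apply: const_unit; exact: negbT.
rewrite mulr_suml; apply: max_ideal_sum => // i _.
rewrite -mulrA mulrC; apply: max_idealMl => //.
have im := ltn_ord i; move: (nat_of_ord i) im => {i} i im.
have -> : t ^+ m = t * t ^+ (m - i.+1) * t ^+ i.
  by rewrite -exprS -exprD subnSK // subnK // ltnW.
rewrite invfM mulrC mulfVK ?expf_neq0 ?t_neq0 // invfM -exprVn.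
apply: max_idealMl => //; apply: subringX => //; exact: max_ideal_sub.
Qed.

(** Both numerator and denominator have the valuation of their leading term. *)
Lemma frac_pole a b : ~ V t -> a != 0 -> b != 0 ->
  unit_of V (im a / im b / t ^ ((size a)%:Z - (size b)%:Z)).
Proof.
move=> Vt a0 b0.
have -> : im a / im b / t ^ ((size a)%:Z - (size b)%:Z) =
    im a / t ^+ (size a).-1 * (im b / t ^+ (size b).-1)^-1.
  have -> : (size a)%:Z - (size b)%:Z = (size a).-1%:Z - (size b).-1%:Z.
    have -> : size a = (size a).-1.+1 by rewrite prednK // size_poly_gt0.
    have -> : size b = (size b).-1.+1 by rewrite prednK // size_poly_gt0.
    by rewrite -!(addn1 _.-1) !PoszD opprD addrACA subrr addr0 !addn1.
  rewrite expfzDr ?t_neq0 // -invr_expz -!exprnP.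
  have ta : t ^+ (size a).-1 != 0 by rewrite expf_neq0 ?t_neq0.
  have tb : t ^+ (size b).-1 != 0 by rewrite expf_neq0 ?t_neq0.
  have := poly_image_neq0 b0.
  move: (im a) (im b) (t ^+ _) (t ^+ _) ta tb => u v ta tb ta0 tb0 v0.
  by field; rewrite ta0 tb0 v0.
apply: unit_ofM => //; first exact: poly_image_pole.
by apply: unit_ofV; exact: poly_image_pole.
Qed.

Lemma A_infty_pole : ~ V t -> base_image (@A_infty k) `<=` V.
Proof.
move=> Vt _ [x /A_inftyP[a [b [b0 ab ->]]] ->]; rewrite frac_alg.
have [->|a0] := eqVneq a 0; first by rewrite poly_image0 mul0r; exact: subring0.
have [_ H _] := frac_pole Vt a0 b0.
have -> : im a / im b = im a / im b / t ^ ((size a)%:Z - (size b)%:Z) *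
    t^-1 ^+ (size b - size a)%N.
  have -> : t^-1 ^+ (size b - size a) = t ^ ((size a)%:Z - (size b)%:Z).
    by rewrite -opprB subzn // -invr_expz -exprnP exprVn.
  by rewrite mulfVK // expfz_neq0 // t_neq0.
apply: subringM => //; apply: subringX => //.
by case: (Vval.2 t).
Qed.

(** Take p of least degree: remainders modulo p of elements of the maximal ideal
    lie in it, hence vanish. *)
Lemma prime_generator : V t -> V <> setT -> exists p,
  [/\ p != 0, max_ideal V (im p) & forall a, max_ideal V (im a) -> p %| a].
Proof.
move=> Vt VT.
have exn : exists n, `[< exists p, [/\ p != 0, max_ideal V (im p) & size p = n] >].
  apply: contrapT => H; apply: VT; apply: (valuation_ring_full Vval) => x.
  have [a [b [b0 ->]]] := alg_frac x.
  apply: subringM => //; first exact: poly_image_sub.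
  apply: contrapT => Vb; apply: H; exists (size b); apply/asboolP.
  by exists b; split=> //; right.
case: (ex_minnP exn) => n /asboolP[p [p0 pm sp]] nmin; exists p; split=> // a am.
rewrite /dvdp -[_ == 0]negbK; apply/negP => r0.
have rm : max_ideal V (im (a %% p)).
  have -> : im (a %% p) = im a + im p * im (- (a %/ p)).
    rewrite -poly_imageM -poly_imageD {2}(divp_eq a p) mulrN [p * _]mulrC addrAC.
    by rewrite subrr add0r.
  by apply: max_idealD => //; apply: max_idealMl => //; exact: poly_image_sub.
have : (n <= size (a %% p)%R)%N by apply: nmin; apply/asboolP; exists (a %% p).
by rewrite leqNgt -sp ltn_modp p0.
Qed.

(** A polynomial outside the maximal ideal is a unit, so splitting off factors
    p ends with a unit. *)
Lemma prime_power p : p != 0 -> max_ideal V (im p) -> V t ->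
  (forall a, max_ideal V (im a) -> p %| a) -> forall a, a != 0 ->
  exists m : nat, unit_of V (im a / im p ^+ m).
Proof.
move=> p0 pm Vt pdvd a; have [N] := ubnP (size a); elim: N a => // N IH a.
rewrite ltnS => sa a0.
have [am|am] := pselect (max_ideal V (im a)); last first.
  exists 0%N; rewrite expr0 divr1; apply: max_ideal_unit => //.
    exact: poly_image_sub.
  exact: poly_image_neq0.
have /dvdpP[q e] := pdvd a am.
have q0 : q != 0 by apply: contraNneq a0 => q0; rewrite e q0 mul0r.
have sp : (1 < size p)%N.
  rewrite ltnNge; apply/negP => /size1_polyC pC.
  have c0 : p`_0 != 0 by apply: contraNneq p0 => c0; rewrite pC c0.
  by apply: (unit_of_max Vval (const_unit c0)); rewrite pC in pm.
have [|m Um] := IH q _ q0.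
  apply: leq_trans sa; rewrite e size_mul // -ltnS prednK.
    by rewrite -addn1 ltn_add2l.
  by rewrite addn_gt0 size_poly_gt0 q0.
exists m.+1; suff -> : im a / im p ^+ m.+1 = im q / im p ^+ m by [].
by rewrite e poly_imageM exprS invfM mulrA mulfK // poly_image_neq0.
Qed.

End OverConstants.

End FunctionFieldPlaces.

Section PlaceFamilies.
Variables (k : fieldType) (F : fieldExtType {fraction {poly k}}).
Local Notation K := {fraction {poly k}}.
Local Notation t := (tF F).
Local Notation im := (@poly_image k F).
Implicit Types (a b p q : {poly k}) (x : K) (y : F) (P Q : place F) (V : set F).

Let val_ring_val P : valuation_ring (val_ring P) :=
  val_ring_valuation (place_valuation P).

Lemma vP_vz P y : y != 0 -> P y = (vz P y)%:E%E.
Proof. exact: (@vval_vz F (place_valuation P)). Qed.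

Lemma val_ring_neq P : val_ring P <> setT.
Proof.
have [y y0 vy] := vval_unif (place_valuation P) (-1) => VT.
have : val_ring P y by rewrite VT.
by rewrite /val_ring /= vP_vz // lee_fin [vz P y]vy.
Qed.

Lemma infinite_place_pole P : infinite_places P -> ~ val_ring P t.
Proof.
move=> iP; have e : [set x : K | (0 < P x%:A)%E] = @P_infty k := iP.
have : @P_infty k (tofrac 1 / tofrac 'X).
  by apply/P_inftyP; exists 1, 'X; rewrite polyX_eq0 size_polyX size_poly1.
rewrite -e /= frac_alg poly_image1 mul1r.
move/(max_ideal_val (place_valuation P)) => [/eqP|]; last by rewrite invrK.
by rewrite invr_eq0 (negPf (t_neq0 F)).
Qed.

Lemma pole_lt0 P : ~ val_ring P t -> vz P t < 0.
Proof.
move=> Vt; rewrite ltNge; apply/negP => vt; apply: Vt.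
by rewrite /val_ring /= vP_vz ?t_neq0 // lee_fin.
Qed.

Lemma pole_degree P x : ~ val_ring P t ->
  P x%:A = ((absz (vz P t))%:Z%:E * - degK x)%E.
Proof.
move=> Vt; have v0 := pole_lt0 Vt; have [a [b [b0 ->]]] := fracP x.
have [->|a0] := eqVneq a 0.
  rewrite tofrac0 mul0r scale0r degK0 (proj2 (vP_eqy P 0) erefl) gt0_muley //.
  by rewrite lte_fin ltz_nat absz_gt0 lt_eqF.
rewrite degK_frac // frac_alg.
have im0 : im a / im b != 0 by rewrite divf_neq0 // poly_image_neq0.
have t0 := t_neq0 F.
have := frac_pole (val_ring_val P) (val_ring_const P) Vt a0 b0.
move/(unit_val (place_valuation P)) => /=.
rewrite vzM ?invr_eq0 ?expfz_neq0 // (vzV (place_valuation P)) ?expfz_neq0 //.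
rewrite (vzXz (place_valuation P)) // => /(_ _)/eqP.
rewrite subr_eq0 => vE; rewrite vP_vz // -EFinM; congr EFin.
rewrite ltz0_abs // mulrNN; apply/eqP; apply: vE.
by rewrite mulf_neq0 ?invr_eq0 ?expfz_neq0.
Qed.

Lemma pole_infinite_place P : ~ val_ring P t -> infinite_places P.
Proof.
move=> Vt; apply/seteqP; have v0 := pole_lt0 Vt.
have H x : (0 < P x%:A)%E <-> (degK x < 0)%E.
  rewrite pole_degree // pmule_rgt0; first by rewrite oppe_gt0.
  by rewrite lte_fin ltz_nat absz_gt0 lt_eqF.
by split=> x /=; [move/H|move=> ?; exact/H].
Qed.

(** Once t has a pole the values of P on K are multiples of the degree
    ([pole_degree]), with a positive factor after a change of sign. *)
Lemma infinite_placeP P : infinite_places P <-> ~ val_ring P t.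
Proof. by split; [exact: infinite_place_pole|exact: pole_infinite_place]. Qed.

Lemma finite_placeP P : finite_places P <-> val_ring P t.
Proof.
split=> [nP|Vt /infinite_placeP//]; apply: contrapT => Vt.
by apply: nP; apply/infinite_placeP.
Qed.

Lemma ramification_indexE P : infinite_places P ->
  ramification_index P = absz (vz P t).
Proof.
move=> /infinite_placeP Vt; rewrite /ramification_index.
case: xgetP => [e _ He|/(_ (absz (vz P t)))]; last first.
  by case=> x; exact: pole_degree.
have := He (tofrac 1 / tofrac 'X); rewrite pole_degree //.
rewrite degK_frac ?oner_neq0 ?polyX_eq0 // size_poly1 size_polyX -!EFinM.
by rewrite opprB (_ : 2%:Z - 1%:Z = 1) // !mulr1 => -[].
Qed.

Lemma ramification_index_gt0 P : infinite_places P -> (0 < ramification_index P)%N.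
Proof.
move=> iP; rewrite ramification_indexE // absz_gt0 lt_eqF // pole_lt0 //.
exact/infinite_placeP.
Qed.

Lemma infinite_place_degree P x : infinite_places P ->
  P x%:A = ((ramification_index P)%:Z%:E * - degK x)%E.
Proof.
by move=> iP; rewrite ramification_indexE //; apply: pole_degree; exact/infinite_placeP.
Qed.

Local Notation inf := (@infinite_places k F : set (places F)).
Local Notation fin := (@finite_places k F : set (places F)).

Let const_A_infty (c : k) : base_image (@A_infty k) (kscale c 1 : F).
Proof.
exists (tofrac c%:P) => //; apply/A_inftyP; exists c%:P, 1.
by rewrite oner_neq0 tofrac1 divr1 size_poly1; split=> //; exact: size_polyC_leq1.
Qed.

Let tinv : K := tofrac 1 / tofrac 'X.

Let tinv_alg : tinv%:A = t^-1 :> F.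
Proof. by rewrite /tinv frac_alg poly_image1 mul1r. Qed.

Let tinv_neq0 : tinv != 0.
Proof. by rewrite /tinv divf_neq0 ?tofrac_neq0 ?oner_neq0 ?polyX_eq0. Qed.

Let tinv_uniformizer P : infinite_places P ->
  uniformizer (@A_infty k) (P : places F) tinv.
Proof.
move=> iP; have Vt := infinite_place_pole iP.
split=> //.
- apply/A_inftyP; exists 1, 'X.
  by rewrite polyX_eq0 size_polyX size_poly1.
- rewrite tinv_alg; apply/(max_ideal_val (place_valuation P)).
  by right; rewrite invrK.
- have e : [set x : K | (0 < P x%:A)%E] = @P_infty k := iP.
  move=> x _ Px; have : P_infty x by rewrite -e.
  move/P_inftyP => [a [b [b0 ab ->]]]; apply/A_inftyP; exists (a * 'X), b; split=> //.
    have [->|a0] := eqVneq a 0; first by rewrite mul0r size_poly0.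
    by rewrite size_mulX.
  by rewrite /tinv tofrac1 div1r invrK tofracM mulrAC.
Qed.

(** If t were in V then every fraction, being an element of the valuation ring
    at infinity times a power of t, would be in V, and V would be F. *)
Let infinite_val V : valuation_ring V -> base_image (@A_infty k) `<=` V -> V <> setT ->
  exists2 P, infinite_places P & val_ring P = V.
Proof.
move=> Vval AV VT; have Vsub := Vval.1.
have Vk c : V (kscale c 1) by exact: (AV _ (const_A_infty c)).
have Vt : ~ V t.
  move=> Vt; apply: VT; apply: (valuation_ring_full Vval) => x.
  have [a [b [b0 ->]]] := fracP x.
  have [ab|/ltnW ba] := leqP (size a) (size b).
    by apply: AV; exists (tofrac a / tofrac b) => //; apply/A_inftyP; exists a, b.
  have XB : 'X^(size a - size b) * b != 0.
    by rewrite mulf_neq0 // -size_poly_eq0 size_polyXn.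
  have -> : (tofrac a / tofrac b)%:A =
      (tofrac a / tofrac ('X^(size a - size b) * b))%:A * t ^+ (size a - size b) :> F.
    rewrite !frac_alg poly_imageM poly_imageX.
    have := poly_image_neq0 F b0; have := expf_neq0 (size a - size b) (t_neq0 F).
    by move: (im a) (im b) (t ^+ _) => u v w w0 v0; field; rewrite v0 w0.
  apply: subringM => //; last exact: subringX.
  apply: AV; exists (tofrac a / tofrac ('X^(size a - size b) * b)) => //.
  apply/A_inftyP; exists a, ('X^(size a - size b) * b); split=> //.
  by rewrite mulrC size_mulXn // subnK.
have [||P VP] := @discrete_place _ _ V tinv Vval Vk tinv_neq0.
- by rewrite tinv_alg; right; rewrite invrK.
- move=> x x0; have [a [b [b0 e]]] := fracP x.
  have a0 : a != 0 by apply: contraNneq x0 => a0; rewrite e a0 tofrac0 mul0r.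
  exists (- ((size a)%:Z - (size b)%:Z)); rewrite tinv_alg exprz_inv opprK e frac_alg.
  exact: frac_pole.
- by exists P => //; apply/infinite_placeP; rewrite VP.
Qed.

Lemma infinite_family : place_family (@A_infty k) inf.
Proof.
split.
- exact: A_infty_subring.
- by move=> P Q _ _; exact: place_eq.
- exact: A_infty_frac.
- move=> P x /infinite_placeP Vt Ax.
  by apply: (A_infty_pole (val_ring_val P) (val_ring_const P) Vt); exists x.
- by move=> P iP; exists tinv; exact: tinv_uniformizer.
- exact: infinite_val.
Qed.

Lemma infinite_places_finite : finite_set (@infinite_places k F).
Proof.
apply: sub_finite_set (finite_above infinite_family tinv) => P iP.
by split=> //; exact: tinv_uniformizer.
Qed.

Lemma infinite_finite_zeros : finite_zeros (@A_infty k) inf.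
Proof.
by move=> x _ _; apply: sub_finite_set infinite_places_finite => P [].
Qed.

(** The valuation ring at infinity is not a field, so Chevalley's theorem
    extends it to a proper valuation ring of F. *)
Lemma infinite_place_exists : exists P : place F, infinite_places P.
Proof.
have Bsub := @base_image_subring _ F _ (@A_infty_subring k).
have tinvA : A_infty tinv.
  by apply/A_inftyP; exists 1, 'X; rewrite polyX_eq0 size_polyX size_poly1.
have [||V [Vval AV JV]] := chevalley (J := [set t^-1]) Bsub.
- by move=> _ ->; exists tinv.
- move=> /(span_mul_principal Bsub)[_ [x Ax ->] /(canLR (mulVKf (t_neq0 F)))].
  rewrite mulr1 => tx; have {tx} tx : tofrac 'X = x by exact: (fmorph_inj (in_alg F)).
  move: Ax; rewrite /A_infty /= -tx -[tofrac 'X]divr1 -tofrac1.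
  by rewrite degK_frac ?oner_neq0 ?polyX_eq0 // size_polyX size_poly1.
have [V1|P iP _] := infinite_val Vval AV; last by exists P.
have [/eqP|] := JV _ erefl; last by rewrite V1; case.
by rewrite invr_eq0 (negPf (t_neq0 F)).
Qed.

Let finite_generator P : finite_places P -> exists p,
  [/\ p != 0, (0 < P (im p))%E & forall a, (0 < P (im a))%E -> p %| a].
Proof.
move=> /finite_placeP Vt; have maxE := max_ideal_val (place_valuation P).
have [p [p0 pm pdvd]] :=
  prime_generator (val_ring_val P) (val_ring_const P) Vt (@val_ring_neq P).
exists p; split=> //; first exact/maxE.
by move=> a /maxE; exact: pdvd.
Qed.

Let generator_uniformizer P p : p != 0 -> (0 < P (im p))%E ->
  (forall a, (0 < P (im a))%E -> p %| a) ->
  uniformizer (@polyK k) (P : places F) (tofrac p).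
Proof.
move=> p0 Pp pdvd; split; [by exists p|exact: tofrac_neq0|exact: Pp|].
move=> _ [a _ <-] /pdvd/dvdpP[q ->]; exists q => //.
by rewrite tofracM (mulfK (tofrac_neq0 p0)).
Qed.

Let finite_val V : valuation_ring V -> base_image (@polyK k) `<=` V -> V <> setT ->
  exists2 P, finite_places P & val_ring P = V.
Proof.
move=> Vval AV VT; have Vsub := Vval.1.
have Vim a : V (im a) by apply: AV; exists (tofrac a) => //; exists a.
have Vk c : V (kscale c 1) by exact: (Vim c%:P).
have Vt : V t by exact: (Vim 'X).
have [p [p0 pm pdvd]] := prime_generator Vval Vk Vt VT.
have [//||P VP] := @discrete_place _ _ V (tofrac p) Vval Vk (tofrac_neq0 p0).
- move=> x x0; have [a [b [b0 e]]] := fracP x.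
  have a0 : a != 0 by apply: contraNneq x0 => a0; rewrite e a0 tofrac0 mul0r.
  have [m Um] := prime_power Vval Vk p0 pm Vt pdvd a0.
  have [l Ul] := prime_power Vval Vk p0 pm Vt pdvd b0.
  exists (m%:Z - l%:Z); rewrite e frac_alg.
  have -> : im a / im b / im p ^ (m%:Z - l%:Z) =
      im a / im p ^+ m * (im b / im p ^+ l)^-1.
    rewrite expfzDr ?poly_image_neq0 // -invr_expz -!exprnP.
    have := poly_image_neq0 F b0.
    have := expf_neq0 m (poly_image_neq0 F p0).
    have := expf_neq0 l (poly_image_neq0 F p0).
    by move: (im a) (im b) (im p ^+ l) (im p ^+ m) => u v w z w0 z0 v0;
      field; rewrite w0 z0 v0.
  by apply: unit_ofM => //; exact: unit_ofV.
- by exists P => //; apply/finite_placeP; rewrite VP.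
Qed.

Lemma finite_family : place_family (@polyK k) fin.
Proof.
split.
- exact: polyK_subring.
- by move=> P Q _ _; exact: place_eq.
- exact: polyK_frac.
- move=> P _ /finite_placeP Vt [a _ <-].
  exact: (poly_image_sub (val_ring_val P) (val_ring_const P) _ Vt).
- move=> P /finite_generator[p [p0 Pp pdvd]]; exists (tofrac p).
  exact: generator_uniformizer.
- exact: finite_val.
Qed.

(** By induction on the degree: if P0 is a zero of c and p generates the prime
    below P0, then p divides c and every zero of p lies over the prime (p). *)
Lemma finite_finite_zeros : finite_zeros (@polyK k) fin.
Proof.
move=> _ [c _ <-]; rewrite tofrac_eq0.
have [N] := ubnP (size c); elim: N c => // N IH c; rewrite ltnS => sc c0.
have [[P0 [fP0 P0c]]|H] :=
  pselect (exists P, finite_places P /\ (0 < P (im c))%E); last first.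
  apply: sub_finite_set (finite_set0 _) => P [fP Pc]; apply: H; by exists P.
have [p [p0 P0p pdvd]] := finite_generator fP0.
have /dvdpP[q e] := pdvd _ P0c.
have q0 : q != 0 by apply: contraNneq c0 => q0; rewrite e q0 mul0r.
have gt1 P a : a != 0 -> (0 < P (im a))%E -> (1 < size a)%N.
  move=> a0 Pa; rewrite ltnNge; apply/negP => /size1_polyC aC.
  have a00 : a`_0 != 0 by apply: contraNneq a0 => a00; rewrite aC a00.
  by move: Pa; rewrite aC (@vP_const k F P) // ltxx.
have dvd_sub P a b : finite_places P -> a %| b -> (0 < P (im a))%E -> (0 < P (im b))%E.
  move=> /finite_placeP Vt /dvdpP[d ->] Pa; rewrite poly_imageM mulrC.
  apply/(max_ideal_val (place_valuation P)); apply: max_idealMl.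
  - exact: val_ring_val.
  - exact/(max_ideal_val (place_valuation P)).
  - exact: (poly_image_sub (val_ring_val P) (val_ring_const P) _ Vt).
have zeroM P a b : finite_places P -> (0 < P (im (a * b)))%E ->
    (0 < P (im a))%E \/ (0 < P (im b))%E.
  move=> fP; rewrite poly_imageM vPM => ab; apply: contrapT => /not_orP[Pa Pb].
  by move: ab; rewrite ltNge => /negP; apply; apply: adde_le0;
    rewrite leNgt; apply/negP.
have sq : (size q < N)%N.
  apply: leq_trans sc; rewrite e size_mul // -ltnS prednK.
    by rewrite -addn1 ltn_add2l (gt1 P0).
  by rewrite addn_gt0 size_poly_gt0 q0.
apply: sub_finite_set (_ : finite_set (_ `|` _)); last first.
  rewrite finite_setU; split; last exact: (IH q sq q0).
  exact: (finite_above finite_family (tofrac p)).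
move=> P [fP]; rewrite e -[X in (0 < _ X)%E]/(im (q * p)).
move=> /(zeroM _ _ _ fP)[Pq|Pp]; [by right|left; split; first exact: fP].
apply: generator_uniformizer => // a Pa.
have [p' [p'0 Pp' p'dvd]] := finite_generator fP.
suff pp' : p %| p' by apply: dvdp_trans pp' _; exact: p'dvd.
have /dvdpP[d pE] := p'dvd _ Pp.
have d0 : d != 0 by apply: contraNneq p0 => d0; rewrite pE d0 mul0r.
have : (0 < P0 (im (d * p')))%E by rewrite -pE.
move=> /(zeroM _ _ _ fP0)[/pdvd pd|]; last exact: pdvd.
exfalso; have := dvdp_leq d0 pd; rewrite pE size_mul //.
have := gt1 _ _ p'0 Pp'; have : (0 < size d)%N by rewrite size_poly_gt0.
case: (size d) (size p') => [//|u] [|[//|v]] // _ _.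
by rewrite addnS /= addnS ltnNge leq_addr.
Qed.

End PlaceFamilies.

(** * Bases of a vector space as sets and as families *)

Section Bases.
Variables (k : fieldType) (W : zmodType) (sc : k -> W -> W).
Hypothesis scDl : forall a b x, sc (a + b) x = sc a x + sc b x.
Hypothesis scDr : forall a x y, sc a (x + y) = sc a x + sc a y.
Hypothesis scA : forall a b x, sc a (sc b x) = sc (a * b) x.
Hypothesis sc1 : forall x, sc 1 x = x.
Implicit Types (S V : set W) (I J : finType).

Let sc0l x : sc 0 x = 0.
Proof. by apply: (addrI (sc 0 x)); rewrite -scDl !addr0. Qed.

Let sc0r a : sc a 0 = 0.
Proof. by apply: (addrI (sc a 0)); rewrite -scDr !addr0. Qed.

Let sc_suml (T : Type) (s : seq T) (c : T -> k) x :
  sc (\sum_(i <- s) c i) x = \sum_(i <- s) sc (c i) x.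
Proof.
elim: s => [|i s IH]; first by rewrite !big_nil sc0l.
by rewrite !big_cons scDl IH.
Qed.

Let sc_sumr (T : Type) (s : seq T) a (f : T -> W) :
  sc a (\sum_(i <- s) f i) = \sum_(i <- s) sc a (f i).
Proof.
elim: s => [|i s IH]; first by rewrite !big_nil sc0r.
by rewrite !big_cons scDr IH.
Qed.

Definition independent I (e : I -> W) :=
  forall c : I -> k, \sum_i sc (c i) (e i) = 0 -> forall i, c i = 0.

Definition family_span I (e : I -> W) : set W :=
  [set y | exists c : I -> k, y = \sum_i sc (c i) (e i)].

(** For W = F and sc = [kscale] this is [is_k_basis]. *)
Definition basis_set S V :=
  (forall (X : {fset W}) (c : W -> k), [set` X] `<=` S ->
     \sum_(x <- X) sc (c x) x = 0 -> forall x, x \in X -> c x = 0) /\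
  V = [set y | exists (X : {fset W}) (c : W -> k),
         [set` X] `<=` S /\ y = \sum_(x <- X) sc (c x) x].

Lemma independent_inj I (e : I -> W) : independent e -> injective e.
Proof.
move=> ind i j eij; apply/eqP/negPn/negP => ij.
have := ind (fun l => (l == i)%:R - (l == j)%:R).
have delta (i0 : I) : \sum_l sc (l == i0)%:R (e l) = e i0.
  rewrite (bigD1 i0) //= eqxx sc1 big1 ?addr0 // => l /negPf ->; exact: sc0l.
have -> : \sum_l sc ((l == i)%:R - (l == j)%:R) (e l) =
    \sum_l sc (l == i)%:R (e l) + sc (-1) (\sum_l sc (l == j)%:R (e l)).
  rewrite sc_sumr -big_split; apply: eq_bigr => l _ /=.
  by rewrite scA mulN1r -scDl.
rewrite !delta eij -{1}[e j]sc1 -scDl subrr sc0l => /(_ erefl i).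
by rewrite eqxx (negPf ij) subr0 => /eqP; rewrite oner_eq0.
Qed.

Lemma sum_over_range I (e : I -> W) (X : {fset W}) (f : W -> W) : injective e ->
  [set` X] `<=` range e -> \sum_(x <- X) f x = \sum_(i | e i \in X) f (e i).
Proof.
move=> einj Xe; rewrite -[RHS]big_filter -[RHS](big_map e xpredT f); apply: perm_big.
apply: uniq_perm;
  [exact: fset_uniq|by rewrite map_inj_uniq ?filter_uniq ?index_enum_uniq|].
move=> x; apply/idP/mapP => [xX|[i + ->]]; last by rewrite mem_filter => /andP[].
by have [i _ eix] := Xe x xX; exists i => //; rewrite mem_filter eix xX mem_index_enum.
Qed.

Lemma family_basis I (e : I -> W) : independent e ->
  basis_set (range e) (family_span e).
Proof.
move=> ind; have einj := independent_inj ind.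
have toI (X : {fset W}) (c : W -> k) : [set` X] `<=` range e ->
    \sum_(x <- X) sc (c x) x = \sum_i sc (if e i \in X then c (e i) else 0) (e i).
  move=> Xe; rewrite (sum_over_range (fun x => sc (c x) x) einj Xe) big_mkcond.
  by apply: eq_bigr => i _; case: ifP => // _; rewrite sc0l.
split=> [X c Xe|].
  rewrite toI // => /ind H x xX; have [i _ eix] := Xe x xX.
  by have := H i; rewrite eix xX.
apply/seteqP; split=> [y [c ->]|y [X [c [Xe ->]]]]; last first.
  by rewrite toI //; exists (fun i => if e i \in X then c (e i) else 0).
have Xe : [set` [fset e i | i in I]%fset] `<=` range e.
  by move=> x /imfsetP[i _ ->]; exists i.
exists [fset e i | i in I]%fset,
  (fun x => if [pick i | e i == x] is Some i then c i else 0).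
split=> //; rewrite toI //; apply: eq_bigr => i _; rewrite in_imfset //.
by case: pickP => [j /eqP /einj -> //|/(_ i)]; rewrite eqxx.
Qed.

Lemma basis_set_family S V d : basis_set S V -> (S #= `I_d)%card ->
  exists (I : finType) (e : I -> W), [/\ independent e, V = family_span e & #|I| = d].
Proof.
move=> [ind VE] Sd; have /finite_fsetP[X SX] : finite_set S.
  by apply/finite_setP; exists d.
exists X, (fun x : X => val x); split.
- move=> c c0; pose c' x := if insub x is Some u then c u else 0.
  have c'E (u : X) : c' (val u) = c u by rewrite /c' valK.
  move=> u; rewrite -c'E; apply: (ind X c') (valP u); first by rewrite SX.
  by rewrite big_seq_fsetE -[RHS]c0; apply: eq_bigr => v _; rewrite c'E.
- rewrite VE; apply/seteqP; split=> [y [Y [c [YS ->]]]|y [c ->]].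
    exists (fun u => if val u \in Y then c (val u) else 0).
    have YX : [set` Y] `<=` range (val : X -> W).
      by move=> x Yx; have := YS _ Yx; rewrite SX => xX; exists [` xX]%fset.
    rewrite (sum_over_range (fun x => sc (c x) x) val_inj YX) big_mkcond.
    by apply: eq_bigr => i _; case: ifP => // _; rewrite sc0l.
  pose c' x := if insub x is Some u then c u else 0.
  exists X, c'; rewrite SX; split=> //; rewrite big_seq_fsetE.
  by apply: eq_bigr => v _; rewrite /c' valK.
- by rewrite -cardfE; apply/card_eq_fsetP; rewrite -SX.
Qed.

(** Expressing each family through the other gives matrices A and B, and the
    independence of e forces A B = 1. *)
Lemma independent_card_le I J (e : I -> W) (f : J -> W) : independent e ->
  family_span e = family_span f -> (#|I| <= #|J|)%N.
Proof.
move=> ind ef; have einj := independent_inj ind.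
have delta (J' : finType) (g : J' -> W) j : family_span g (g j).
  exists (fun l => (l == j)%:R); rewrite (bigD1 j) //= eqxx sc1 big1 ?addr0 //.
  by move=> l /negPf ->; exact: sc0l.
have /choice[M HM] : forall i, exists c : J -> k, e i = \sum_j sc (c j) (f j).
  by move=> i; have := delta _ e i; rewrite ef.
have /choice[N HN] : forall j, exists c : I -> k, f j = \sum_i sc (c i) (e i).
  by move=> j; have := delta _ f j; rewrite -ef.
pose A := \matrix_(i < #|I|, j < #|J|) M (enum_val i) (enum_val j).
pose B := \matrix_(j < #|J|, i < #|I|) N (enum_val j) (enum_val i).
apply: (@mulmx1_min _ _ _ A B); apply/matrixP => i i'; rewrite !mxE.
under eq_bigr do rewrite !mxE.
set u := enum_val i; set u' := enum_val i'.
transitivity (\sum_j M u j * N j u').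
  by rewrite [RHS](reindex _ (onW_bij _ (@enum_val_bij J))).
have := ind (fun l => \sum_j M u j * N j l - (u == l)%:R).
have -> : \sum_l sc (\sum_j M u j * N j l - (u == l)%:R) (e l) = 0.
  have -> : \sum_l sc (\sum_j M u j * N j l - (u == l)%:R) (e l) =
      \sum_l sc (\sum_j M u j * N j l) (e l) + sc (-1) (\sum_l sc (u == l)%:R (e l)).
    rewrite sc_sumr -big_split; apply: eq_bigr => l _ /=.
    by rewrite scA mulN1r -scDl.
  have -> : \sum_l sc (u == l)%:R (e l) = e u.
    rewrite (bigD1 u) //= eqxx sc1 big1 ?addr0 // => l.
    by rewrite eq_sym => /negPf ->; exact: sc0l.
  have -> : \sum_l sc (\sum_j M u j * N j l) (e l) = e u.
    under eq_bigr do rewrite sc_suml.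
    rewrite exchange_big /= [RHS]HM; apply: eq_bigr => j _.
    by rewrite [f j]HN sc_sumr; apply: eq_bigr => l _; rewrite scA.
  by rewrite -{1}[e u]sc1 -scDl subrr sc0l.
move=> /(_ erefl u') /eqP; rewrite subr_eq0 => /eqP ->.
by rewrite (inj_eq enum_val_inj).
Qed.

Lemma independent_card I J (e : I -> W) (f : J -> W) : independent e ->
  independent f -> family_span e = family_span f -> #|I| = #|J|.
Proof.
move=> inde indf ef; apply/eqP; rewrite eqn_leq (independent_card_le inde ef).
by rewrite (independent_card_le indf (esym ef)).
Qed.

End Bases.

(** * Norms of divisors and Riemann-Roch spaces *)

Section RiemannRoch.
Variables (k : fieldType) (F : fieldExtType {fraction {poly k}}).
Local Notation K := {fraction {poly k}}.
Local Notation t := (tF F).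
Local Notation im := (@poly_image k F).
Implicit Types (P : place F) (D : place F -> int) (V : set F) (z : F).

Lemma kscaleE (c : k) z : kscale c z = im c%:P * z.
Proof. by rewrite mulr_algl. Qed.

Lemma kscaleDl (a b : k) z : kscale (a + b) z = kscale a z + kscale b z.
Proof. by rewrite !kscaleE polyCD poly_imageD mulrDl. Qed.

Lemma kscaleDr (a : k) x z : kscale a (x + z) = kscale a x + kscale a z.
Proof. by rewrite !kscaleE mulrDr. Qed.

Lemma kscaleA (a b : k) z : kscale a (kscale b z) = kscale (a * b) z.
Proof. by rewrite !kscaleE mulrA -poly_imageM polyCM. Qed.

Lemma kscale1 z : kscale 1 z = z.
Proof. by rewrite kscaleE poly_image1 mul1r. Qed.

Lemma dim_k_family (I : finType) (e : I -> F) V : independent (@kscale k F) e ->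
  V = family_span (@kscale k F) e -> dim_k V = #|I|.
Proof.
move=> ind VE; have einj := independent_inj kscaleDl kscaleDr kscaleA kscale1 ind.
rewrite /dim_k; case: xgetP => [d _ [S [bS Sd]]|/(_ #|I|)[]]; last first.
  exists (range e); split.
    by rewrite VE; exact: (family_basis kscaleDl kscaleDr kscaleA kscale1 ind).
  have -> : range e = [set` [fset e i | i in I]%fset].
    apply/seteqP; split=> [x [i _ <-]|x /imfsetP[i _ ->]]; last by exists i.
    by apply/imfsetP; exists i.
  by apply/card_eq_fsetP; rewrite card_imfset //= -cardE.
have [J [f [indf Vf <-]]] := basis_set_family kscaleDl bS Sd.
apply: (independent_card kscaleDl kscaleDr kscaleA kscale1 indf ind).
by rewrite -Vf.
Qed.

Lemma le_fsbig_min (T : choiceType) (R : realDomainType) (A : set T)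
    (f : T -> \bar R) (x : \bar R) : finite_set A ->
  (x <= \big[Order.min/+oo%E]_(i \in A) f i)%E <-> forall i, A i -> (x <= f i)%E.
Proof.
move=> Afin; set s := finite_support _ _ _.
have -> : (x <= \big[Order.min/+oo%E]_(i <- s) f i)%E <->
    forall i, i \in s -> (x <= f i)%E.
  elim: s => [|i s IH]; first by rewrite big_nil leey.
  rewrite big_cons le_min; split=> [/andP[xi /IH H] j|H].
    by rewrite inE => /predU1P[->|/H].
  by rewrite H ?mem_head //; apply/IH => j js; rewrite H // inE js orbT.
have fin : finite_set (A `&` f @^-1` [set~ +oo%E]) by exact: finite_setIl.
split=> H i.
  move=> Ai; have [->|fi] := eqVneq (f i) +oo%E; first by rewrite leey.
  by apply: H; rewrite in_finite_support // inE; split=> //; exact/eqP.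
by rewrite in_finite_support // inE => -[/H].
Qed.

(** Rounding up the norm turns it into the integral conditions on the
    valuations at infinity that define a Riemann-Roch space. *)
Lemma ceil_norm_le D z (m : int) : (ceilE (normD D z) <= m%:E)%E <->
  forall P, infinite_places P ->
    ((- (m * (ramification_index P)%:Z))%:E <= P z + (D P)%:E)%E.
Proof.
have -> : (ceilE (normD D z) <= m%:E)%E = (normD D z <= (m%:~R)%:E)%E.
  by case: (normD D z) => [q||] //=; rewrite ?leNye // !lee_fin ceil_le_int.
rewrite /normD leeNl; set g := fun P => er_map _ _.
have -> := @le_fsbig_min _ _ (@infinite_places k F) g (- (m%:~R : rat)%:E)%E
  (@infinite_places_finite k F).
suff H P : infinite_places P -> (- (m%:~R : rat)%:E <= g P)%E =
    ((- (m * (ramification_index P)%:Z))%:E <= P z + (D P)%:E)%E.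
  by split=> h P iP; have := h P iP; rewrite H.
move=> iP; rewrite /g; have [->|z0] := eqVneq z 0.
  by rewrite (proj2 (vP_eqy P 0) erefl) /= !leey.
rewrite vP_vz // -EFinD /= !lee_fin.
have e0 : 0 < (ramification_index P)%:R :> rat.
  by rewrite ltr0n ramification_index_gt0.
by rewrite ler_pdivlMr // -mulNr -intrN pmulrn -intrM ler_int.
Qed.

(** The minimum runs over a finite and nonempty set. *)
Lemma ceil_norm_fin D z : z != 0 -> exists m : int, ceilE (normD D z) = m%:E%E.
Proof.
move=> z0; have fin := @infinite_places_finite k F.
pose u P := vz P z + D P.
have uE P : (P z + (D P)%:E)%E = (u P)%:E%E by rewrite vP_vz.
have [M HM] : exists M : int, (ceilE (normD D z) <= M%:E)%E.
  pose s := fset_set (@infinite_places k F).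
  exists (\sum_(P <- s) `|u P|); apply/ceil_norm_le => P iP; rewrite uE lee_fin.
  have Ps : P \in s by rewrite in_fset_set // inE.
  have e1 : 1 <= (ramification_index P)%:Z by exact: ramification_index_gt0.
  rewrite lerNl; apply: le_trans (_ : `|u P| <= _); first by rewrite -normrN ler_norm.
  rewrite (bigD1_seq P) ?fset_uniq //=; set v := \sum_(_ <- _ | _) _.
  have v0 : 0 <= v by apply: sumr_ge0.
  apply: le_trans (_ : `|u P| + v <= _); first by rewrite lerDl.
  by rewrite ler_peMr // addr_ge0.
have [P iP] := infinite_place_exists F.
have := @ceil_norm_le D z; move: HM; case: (ceilE _) => [m||] // _ H; first by exists m.
have /(H _) := leNye (- (`|u P| + 1))%:E%E.
move=> /(_ P iP); rewrite uE lee_fin mulNr opprK leNgt => /negP; case.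
apply: le_lt_trans (ler_norm _) _; apply: lt_le_trans (_ : `|u P| + 1 <= _).
  by rewrite ltrDl.
by rewrite ler_peMr ?addr_ge0 //; exact: ramification_index_gt0.
Qed.

Lemma ideal_finE D : is_divisor D ->
  ideal_fin D = [set x | forall P, finite_places P -> ((- D P)%:E <= P x)%E].
Proof.
move=> Dfin; rewrite /ideal_fin.
have -> : @O_fin k F = @hol_ring _ F (places F) (@finite_places k F).
  exact: (hol_ring_integral (finite_family F)).
apply: (prod_divisorial (finite_family F) (@finite_finite_zeros k F)
  (D := fun P => - D P)).
by apply: sub_finite_set Dfin => P [_]; rewrite oppr_eq0.
Qed.

Lemma ideal_infE D : is_divisor D ->
  ideal_inf D = [set x | forall P, infinite_places P -> ((- D P)%:E <= P x)%E].
Proof.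
move=> Dfin; rewrite /ideal_inf.
have -> : @O_inf k F = @hol_ring _ F (places F) (@infinite_places k F).
  exact: (hol_ring_integral (infinite_family F)).
apply: (prod_divisorial (infinite_family F) (@infinite_finite_zeros k F)
  (D := fun P => - D P)).
by apply: sub_finite_set Dfin => P [_]; rewrite oppr_eq0.
Qed.

Lemma norm_le0E D : is_divisor D -> ideal_inf D = norm_le0 (normD D).
Proof.
move=> Ddiv; rewrite ideal_infE //; apply/seteqP.
have H z : norm_le0 (normD D) z <->
    forall P, infinite_places P -> ((- D P)%:E <= P z)%E.
  have -> : norm_le0 (normD D) z <-> (ceilE (normD D z) <= 0%:E)%E.
    rewrite /norm_le0 /=; case: (normD D z) => [q||] //=.
    by rewrite !lee_fin ceil_le0.
  have E P : (0%:E <= P z + (D P)%:E)%E = ((- D P)%:E <= P z)%E.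
    have [->|z0] := eqVneq z 0; first by rewrite (proj2 (vP_eqy P 0) erefl) !leey.
    by rewrite vP_vz // -EFinD !lee_fin -lerBlDr sub0r.
  by rewrite ceil_norm_le; split=> h P iP; have := h P iP; rewrite mul0r oppr0 E.
by split=> z /=; [move=> h; exact/H|move/H].
Qed.

(** The infinite places impose the bound on the norm, the finite ones
    membership in the ideal. *)
Lemma riemann_rochE D (r : int) : is_divisor D ->
  riemann_roch (fun P => D P + r * t_infty P) =
  [set x | ideal_fin D x /\ (ceilE (normD D x) <= r%:E)%E].
Proof.
move=> Ddiv; rewrite ideal_finE //; apply/seteqP.
have tinf P : infinite_places P -> t_infty P = (ramification_index P)%:Z.
  by move=> iP; rewrite /t_infty mem_set.
have tfin P : finite_places P -> t_infty P = 0.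
  by move=> fP; rewrite /t_infty memNset.
split=> x.
  case=> [[x0 H]|->]; split=> [P fP|].
  - by have := H P; rewrite tfin // mulr0 addr0.
  - apply/ceil_norm_le => P iP; have := H P; rewrite tinf // vP_vz // -EFinD !lee_fin.
    by rewrite opprD [- _ - _]addrC lerBlDr.
  - by rewrite (proj2 (vP_eqy P 0) erefl) leey.
  - by apply/ceil_norm_le => P iP; rewrite (proj2 (vP_eqy P 0) erefl) leey.
move=> [Ix /ceil_norm_le Nx]; have [->|x0] := eqVneq x 0; first by right.
left; split=> // P; have [iP|fP] := pselect (infinite_places P).
  have := Nx P iP; rewrite tinf // vP_vz // -EFinD !lee_fin.
  by rewrite opprD [- _ - _]addrC lerBlDr.
by have := Ix P fP; rewrite tfin // mulr0 addr0.
Qed.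

End RiemannRoch.

(** * Semi-reduced bases *)

Section ReducedBases.
Variables (k : fieldType) (F : fieldExtType {fraction {poly k}}).
Local Notation t := (tF F).
Local Notation im := (@poly_image k F).

(** It counts the naturals j <= r - c, see [ltn_gap]. *)
Definition gap (r c : int) : nat := if c <= r then (absz (r - c)).+1 else 0.

Lemma ltn_gap (r c : int) (j : nat) : (j < gap r c)%N = (j%:Z <= r - c).
Proof.
rewrite /gap -subr_ge0; case: (r - c) => m /=; first by rewrite ltnS lez_nat.
by rewrite ltn0.
Qed.

(** At every infinite place a polynomial of degree d has valuation - d e(P), so
    that multiplication by it shifts the norm by d. *)
Lemma ceil_norm_scale (D : place F -> int) (a : {poly k}) (z : F) (r c : int) :
  ceilE (normD D z) = c%:E%E ->
  (ceilE (normD D (tofrac a *: z)) <= r%:E)%E = (size a <= gap r c)%N.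
Proof.
move=> Nz; have [->|a0] := eqVneq a 0.
  rewrite size_poly0 leq0n tofrac0 scale0r; apply/ceil_norm_le => P _.
  by rewrite (proj2 (vP_eqy P 0) erefl) leey.
have sa : (0 < size a)%N by rewrite size_poly_gt0.
rewrite -(prednK sa) ltn_gap; set d := (size a).-1.
have dE : degK (tofrac a) = d%:Z%:E%E.
  rewrite -[tofrac a]divr1 -tofrac1 degK_frac ?oner_neq0 // size_poly1.
  by rewrite -(prednK sa) -addn1 PoszD addrK.
have -> : (d%:Z <= r - c) = (ceilE (normD D z) <= (r - d%:Z)%:E)%E.
  by rewrite Nz lee_fin lerBrDl addrC -lerBrDl lerBrDr addrC -lerBrDr.
suff H P : infinite_places P ->
    ((- (r * (ramification_index P)%:Z))%:E <= P (tofrac a *: z) + (D P)%:E)%E =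
    ((- ((r - d%:Z) * (ramification_index P)%:Z))%:E <= P z + (D P)%:E)%E.
  by apply/idP/idP => /ceil_norm_le h; apply/ceil_norm_le => P iP;
    have := h P iP; rewrite H.
move=> iP; have -> : tofrac a *: z = im a * z by rewrite mulr_algl.
rewrite vPM (infinite_place_degree (tofrac a) iP) dE.
have [->|z0] := eqVneq z 0.
  by rewrite (proj2 (vP_eqy P 0) erefl) /= !leey.
rewrite vP_vz // -!EFinM -!EFinD !lee_fin -[LHS]subr_ge0 -[RHS]subr_ge0.
by congr (0 <= _); ring.
Qed.

Variables (n : nat) (b : 'I_n -> F) (m : 'I_n -> nat).

Definition power_family (u : {i : 'I_n & 'I_(m i)}) : F := b (tag u) * t ^+ (tagged u).

Definition coef_poly (c : {i : 'I_n & 'I_(m i)} -> k) (i : 'I_n) : {poly k} :=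
  \sum_(j < m i) (c (Tagged (fun i => 'I_(m i)) j))%:P * 'X^j.

Lemma coef_polyE c i (j : 'I_(m i)) :
  (coef_poly c i)`_j = c (Tagged (fun i => 'I_(m i)) j).
Proof.
rewrite coef_sum (bigD1 j) //= coefCM coefXn eqxx mulr1 big1 ?addr0 // => l lj.
rewrite coefCM coefXn; case: eqP => [jl|_]; last by rewrite mulr0.
by move: lj; rewrite -(inj_eq val_inj) /= jl eqxx.
Qed.

Lemma size_coef_poly c i : (size (coef_poly c i) <= m i)%N.
Proof.
apply: leq_trans (size_sum _ _ _) _; apply/bigmax_leqP => j _.
by rewrite mul_polyC; apply: leq_trans (size_scale_leq _ _) _; rewrite size_polyXn.
Qed.

Lemma sum_power_family c :
  \sum_u kscale (c u) (power_family u) = \sum_i tofrac (coef_poly c i) *: b i.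
Proof.
have scE (a : {poly k}) z : tofrac a *: z = im a * z :> F by rewrite mulr_algl.
have imS (I : Type) (s : seq I) (f : I -> {poly k}) :
    im (\sum_(i <- s) f i) = \sum_(i <- s) im (f i).
  elim: s => [|i s IH]; first by rewrite !big_nil poly_image0.
  by rewrite !big_cons poly_imageD IH.
transitivity (\sum_i \sum_(j < m i)
    kscale (c (Tagged (fun i => 'I_(m i)) j)) (b i * t ^+ j)).
  rewrite (sig_big_dep xpredT (fun _ => xpredT) (fun i (j : 'I_(m i)) =>
    kscale (c (Tagged (fun i => 'I_(m i)) j)) (b i * t ^+ j))) /=.
  by apply: eq_bigr => -[i j] _.
apply: eq_bigr => i _; rewrite scE imS mulr_suml; apply: eq_bigr => j _.
by rewrite kscaleE poly_imageM poly_imageX -mulrA [b i * _]mulrC.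
Qed.

Lemma coef_polyK (a : 'I_n -> {poly k}) : (forall i, (size (a i) <= m i)%N) ->
  exists c, forall i, coef_poly c i = a i.
Proof.
move=> sa; exists (fun u : {i : 'I_n & 'I_(m i)} => (a (tag u))`_(tagged u)) => i.
apply/polyP => j.
have [jm|mj] := ltnP j (m i); first by rewrite (coef_polyE _ (Ordinal jm)).
by rewrite !nth_default // (leq_trans _ mj) // size_coef_poly.
Qed.

End ReducedBases.

Theorem corollary3p2 (k : fieldType) (F : fieldExtType {fraction {poly k}})
    (n : nat) (F_sep : separable 1%VS {:F}%VS) (F_deg : \dim {:F}%VS = n)
    (D : place F -> int) (D_div : is_divisor D) (r : int) (b : 'I_n -> F)
    (b_basis : is_A_basis b (ideal_fin D))
    (b_red : semi_reduced (normD D) b) :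
  let c := fun i : 'I_n => ceilE (normD D (b i)) in
  let L := riemann_roch (fun P => D P + r * t_infty P) in
  [/\ ideal_inf D = norm_le0 (normD D),
      is_k_basis
        [set x | exists (i : 'I_n) (j : nat),
           ((j%:Z)%:E <= - c i + r%:E)%E /\ x = b i * tF F ^+ j] L
    & ((dim_k L)%:Z)%:E =
        (\sum_(i < n | c i <= r%:E) (- c i + r%:E + 1))%E].
Proof.
move=> c L; have [bgen bfree] := b_basis.
have b0 i : b i != 0.
  apply/eqP => bi; have := bfree (fun j => (j == i)%:R).
  rewrite big1 => [/(_ erefl i)/eqP|j _]; first by rewrite eqxx oner_eq0.
  by case: eqP => [->|_]; rewrite ?bi ?scaler0 // tofrac0 scale0r.
have /choice[c' c'E] : forall i, exists m : int, c i = m%:E%E.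
  by move=> i; exact: ceil_norm_fin.
pose m i := gap r (c' i); pose e := @power_family k F n b m.
have ind : independent (@kscale k F) e.
  move=> d; rewrite sum_power_family => /bfree d0 [i j].
  by rewrite -(@coef_polyE k n m d i j) d0 coef0.
have LE : L = family_span (@kscale k F) e.
  rewrite /L riemann_rochE //; apply/seteqP.
  (* semi-reducedness separates the coefficients *)
  have normE (a : 'I_n -> {poly k}) :
      (ceilE (normD D (\sum_i tofrac (a i) *: b i)) <= r%:E)%E <->
      forall i, (size (a i) <= m i)%N.
    rewrite b_red; split=> [/bigmax_leP[_ H] i|H].
      by rewrite -(ceil_norm_scale (a i) r (c'E i)); exact: H.
    apply/bigmax_leP; split=> [|i _]; first exact: leNye.
    by rewrite (ceil_norm_scale (a i) r (c'E i)).
  split=> x.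
    move=> []; rewrite {1}bgen => -[a _ <-] /normE /coef_polyK[d dE].
    by exists d; rewrite sum_power_family; apply: eq_bigr => i _; rewrite dE.
  move=> [d ->]; rewrite sum_power_family; split.
    by rewrite bgen; exists (coef_poly d).
  by apply/normE => i; exact: size_coef_poly.
split; first exact: norm_le0E.
  have -> : [set x | exists (i : 'I_n) (j : nat),
      ((j%:Z)%:E <= - c i + r%:E)%E /\ x = b i * tF F ^+ j] = range e.
    have mE i (j : nat) : ((j%:Z)%:E <= - c i + r%:E)%E = (j < m i)%N.
      by rewrite c'E -EFinN -EFinD lee_fin ltn_gap addrC.
    apply/seteqP; split=> [x [i [j [jm ->]]]|_ [[i j] _ <-]].
      rewrite mE in jm; by exists (Tagged (fun i => 'I_(m i)) (Ordinal jm)).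
    by exists i, j; rewrite mE ltn_ord.
  rewrite LE.
  exact: (family_basis (@kscaleDl k F) (@kscaleDr k F) (@kscaleA k F)
    (@kscale1 k F) ind).
rewrite (dim_k_family ind LE) card_tagged sumnE big_map big_enum /=.
rewrite [RHS](eq_bigl (fun i => c' i <= r)) => [|i]; last by rewrite c'E lee_fin.
rewrite [RHS](eq_bigr (fun i => (- c' i + r + 1)%:E%E)) => [|i _]; last first.
  by rewrite c'E -EFinN -!EFinD.
rewrite sumEFin; congr EFin;
rewrite [RHS]big_mkcond (big_morph Posz PoszD (erefl _)) /=.
apply: eq_bigr => i _; rewrite card_ord /m /gap; case: ifP => // ir.
by rewrite -addn1 PoszD gez0_abs ?subr_ge0 // [r - _]addrC.
Qed.
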